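(* There is an absolute constant $K>0$ such that the following holds. Let $\epsilon>0$ and let $G=(V,E)$ be a graph on $n$ vertices with maximal degree $\Delta$ such that $(1+\epsilon)\Delta\ge \Delta+2$ and such that $\epsilon\Delta$, $(1+\epsilon)\Delta$ and $(1+\epsilon)\epsilon^{-1}$ are integers. Then for every $\delta\in(0,1)$ the mixing time $\tau(\delta)$ of the Single-Flaw dynamics Markov chain $\mathcal{MC}(G,\epsilon)$ satisfies $$\tau(\delta)\le K\,\mathrm{pw}(G)\,(1+\epsilon)^3\Delta^3 n^5\left((1+\epsilon)\epsilon^{-1}\right)^{2\,\mathrm{pw}(G)}\left(n\log n+\ln\delta^{-1}\right),$$ where $\mathrm{pw}(G)$ is the pathwidth of $G$. In particular, for fixed $\epsilon$, on any family of such graphs with $\mathrm{pw}(G)=O(\log n)$ the chain mixes in polynomial time, i.e. $\tau(1/(2e))$ is bounded by a polynomial in $n$.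
   Context: Graphs are finite, simple and undirected. A $k$-coloring of $G$ is any map $\sigma:V\to[k]=\{1,\dots,k\}$; an edge $(u,v)\in E$ is monochromatic if $\sigma(u)=\sigma(v)$. The coloring is proper if it has no monochromatic edge; it is singly-flawed if it has at least one monochromatic edge and there is a vertex $v$ contained in all monochromatic edges. $\mathcal C_p(G,k)$ and $\mathcal C_{sf}(G,k)$ denote the sets of proper and of singly-flawed $k$-colorings of $G$. The Single-Flaw dynamics $\mathcal{MC}(G,\epsilon)$ is the Markov chain with state space $\Omega=\mathcal C_p(G,k)\cup\mathcal C_{sf}(G,k)$, $k=(1+\epsilon)\Delta$, and the following transitions from $\sigma\in\Omega$: with probability $1/2$ stay at $\sigma$; otherwise choose $v\in V$ and $c\in[k]$ independently and uniformly at random, and let $\sigma'$ be $\sigma$ with the color of $v$ replaced by $c$; move to $\sigma'$ if $\sigma'\in\Omega$, and stay at $\sigma$ if $\sigma'\notin\Omega$. Its stationary distribution $\pi$ is uniform on $\Omega$. With $P$ the transition matrix and $d_{TV}(\mu,\nu)=\max_{S\subseteq\Omega}|\mu(S)-\nu(S)|$, the mixing time from $\sigma$ is $\tau_\sigma(\delta)=\min\{\bar t: d_{TV}(P^t(\sigma,\cdot),\pi)\le\delta \text{ for all } t\ge \bar t\}$ and $\tau(\delta)=\max_{\sigma\in\Omega}\tau_\sigma(\delta)$. *)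

(* Defs.v *)
From HB Require Import structures.
From mathcomp Require Import all_boot all_order all_algebra.
From mathcomp Require Import all_classical all_reals all_analysis.

Set Implicit Arguments.
Unset Strict Implicit.
Unset Printing Implicit Defensive.

Import Order.TTheory GRing.Theory Num.Theory.

Local Open Scope ring_scope.

Record sgraph := SGraph {
  vertex :> finType;
  edge : rel vertex;
  edge_sym : symmetric edge;
  edge_irr : irreflexive edge }.

Definition max_degree (G : sgraph) : nat :=
  (\max_(v : G) #|[set u : G | edge v u]|)%N.

(* The bags of a path decomposition, listed along the path.                   *)
Definition path_decomposition (G : sgraph) (X : seq {set G}) : Prop :=
  [/\ forall v : G, exists2 B, B \in X & v \in B,
      forall u v : G, edge u v -> exists2 B, B \in X & (u \in B) && (v \in B)
    & forall i j l : nat, (i <= j <= l)%N -> (l < size X)%N ->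
        nth finset.set0 X i :&: nth finset.set0 X l \subset nth finset.set0 X j].

(* Truncated subtraction only matters for the graph without vertices, whose   *)
(* width is 0 here.                                                           *)
Definition pd_width (G : sgraph) (X : seq {set G}) : nat :=
  (\max_(B <- X) #|B|)%N.-1.

Definition has_pd_width (G : sgraph) (w : nat) : bool :=
  `[< exists2 X : seq {set G}, path_decomposition X & pd_width X = w >].

Lemma ex_pd_width (G : sgraph) : exists w, has_pd_width G w.
Proof.
exists (pd_width [:: [set: G]]); apply/asboolP; exists [:: [set: G]] => //; split.
- by move=> v; exists [set: G]; rewrite ?inE.
- by move=> u v _; exists [set: G]; rewrite ?inE.
- move=> i j l /andP[ij jl]; rewrite /= ltnS leqn0 => /eqP l0.
  by move: jl; rewrite l0 leqn0 => /eqP ->; rewrite finset.subsetIr.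
Qed.

Definition pathwidth (G : sgraph) : nat := ex_minn (ex_pd_width G).

Section Colorings.
Variables (G : sgraph) (k : nat).
Implicit Type s : {ffun G -> 'I_k}.

Definition monochromatic s (u v : G) : bool := edge u v && (s u == s v).

Definition proper_coloring s : bool :=
  ~~ [exists u, exists v, monochromatic s u v].

Definition singly_flawed s : bool :=
  [exists u, exists v, monochromatic s u v] &&
  [exists w, forall u, forall v,
     monochromatic s u v ==> ((w == u) || (w == v))].

Definition sf_state : Type :=
  {s : {ffun G -> 'I_k} | proper_coloring s || singly_flawed s}.

HB.instance Definition _ := SubFinite.on sf_state.

Definition recolor s (v : G) (c : 'I_k) : {ffun G -> 'I_k} :=
  [ffun u => if u == v then c else s u].

(* insubd x keeps x when the recolored map is not a state.                    *)
Definition sf_move (x : sf_state) (v : G) (c : 'I_k) : sf_state :=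
  insubd x (recolor (val x) v c).

Definition sf_trans (R : realType) (x y : sf_state) : R :=
  2^-1 * (x == y)%:R +
  2^-1 * \sum_(v : G) \sum_(c < k)
           (#|G|%:R * k%:R)^-1 * (sf_move x v c == y)%:R.

End Colorings.

Section MixingTime.
Variables (R : realType) (S : finType).
Implicit Types (mu nu : S -> R) (P : S -> S -> R).

Fixpoint trans_pow P (t : nat) (x y : S) : R :=
  if t is t'.+1 then \sum_(z : S) P x z * trans_pow P t' z y else (x == y)%:R.

Definition uniform_dist : S -> R := fun=> #|S|%:R^-1.

Definition dTV mu nu : R :=
  \big[Num.max/0]_(A : {set S}) `|\sum_(x in A) mu x - \sum_(x in A) nu x|.

(* Extended-real valued, so that the time is +oo when the set is empty, i.e.  *)
(* when the chain started at x never stays delta-close to pi.                 *)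
Definition mixing_time_from P pi (x : S) (delta : R) : \bar R :=
  ereal_inf [set t0%:R%:E | t0 in
    [set t0 : nat | forall t, (t0 <= t)%N -> dTV (trans_pow P t x) pi <= delta]]%classic.

Definition mixing_time P pi (delta : R) : \bar R :=
  \big[maxe/-oo%E]_(x : S) mixing_time_from P pi x delta.

End MixingTime.

Section SingleFlaw.
Variables (R : realType) (G : sgraph) (eps : R).

Definition admissible : Prop :=
  [/\ 0 < eps,
      (max_degree G)%:R + 2 <= (1 + eps) * (max_degree G)%:R,
      eps * (max_degree G)%:R \is a Num.int,
      (1 + eps) * (max_degree G)%:R \is a Num.int
    & (1 + eps) * eps^-1 \is a Num.int].

(* Equal to (1 + eps) * max_degree G as soon as admissible holds.             *)
Definition num_colors : nat := Num.truncn ((1 + eps) * (max_degree G)%:R).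

Definition sf_mixing_time (delta : R) : \bar R :=
  mixing_time (@sf_trans G num_colors R) (@uniform_dist R _) delta.

End SingleFlaw.

(* Main.v *)
(* Eliminating the vertices in the order in which they leave the bags of an   *)
(* optimal path decomposition, every initial segment has at most pw(G) outer  *)
(* neighbors. Two proper colorings s and t are joined by a random path that   *)
(* processes the vertices in this order: recolor u by t(u), which can only    *)
(* create monochromatic edges at u, hence a single flaw; then recolor each    *)
(* later neighbor of u by a uniform one of q = eps * Delta available colors.  *)
(* At any time the segment A already processed has its colors from t, the     *)
(* boundary D is random, and the rest has its colors from s. A given state is *)
(* thus hit with probability at most q^-|D| for given (s, t), and the pairs   *)
(* (s, t) compatible with it are counted through the hybrid coloring equal to *)
(* s on A and to t beyond D: at most k^(2|D|+1) pairs for every q^(|D|+1)     *)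
(* hybrids, whence a congestion of order (k/q)^(2 pw(G)) = ((1+eps)/eps)^(2   *)
(* pw(G)) and a Poincare inequality on the proper colorings. It extends to    *)
(* flawed states because each is one move away from a proper coloring, and a  *)
(* lazy symmetric chain contracts the L2 distance to uniform by its gap.      *)

Require Import Defs.
From HB Require Import structures.
From mathcomp Require Import all_boot all_order all_algebra.
From mathcomp Require Import all_classical all_reals all_analysis.
From mathcomp Require Import zify ring lra.

Set Implicit Arguments.
Unset Strict Implicit.
Unset Printing Implicit Defensive.

Import Order.TTheory GRing.Theory Num.Theory.

Local Open Scope ring_scope.

(** * L2 mixing of lazy symmetric chains *)

(** The transition matrix is symmetric and lazy, so a Poincare inequality with constant [gap] makes
    the squared L2 distance to the uniform distribution at most [(1 - gap) ^+ t] after [t] steps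
    ([l2_decay]). By Cauchy-Schwarz, [mixing_time_le] then gives a mixing time of order
    [(ln #|S| + 2 ln delta^-1) / gap]. It remains to bound [gap] below, which is done by random
    canonical paths.

    The variance of [g] over the proper colorings is an average of [(g s - g t) ^+ 2]. Along a
    random path of at most [n ^ 2] single-vertex moves from [s] to [t], Cauchy-Schwarz bounds this
    by the length times the expected sum of squared increments ([displacement_rcons]). At any fixed
    time a given state is visited with total weight at most [#|proper_set| (k/q) ^ (2p + 1)] over
    all pairs ([count_visits_le]), where [p = pw(G)] bounds every boundary in the order given by
    [elimination_order]. Each of the [n] stages updates a vertex at most once, so the energy of all
    moves is charged at most [n] times, and [proper_energy] gets the factor [n ^ 3].

    Including the flawed states costs a further [n k] ([variance_energy]), and normalizing the
    Dirichlet form costs [4 n k] ([dirichlet_energy]). Hence [gap^-1] is of order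
    [n^5 k^2 (k/q)^(2p+1)], which is at most [n^5 k^3 (k/q)^(2p)]. Finally [k <= 2n] gives
    [ln #|S| <= 2 n ln n]. *)

Lemma sqr_sum_le (R : realType) (I : finType) (A : {set I}) (F : I -> R) :
  (\sum_(i in A) F i) ^+ 2 <= #|A|%:R * \sum_(i in A) F i ^+ 2.
Proof.
have h : 0 <= \sum_(i in A) \sum_(j in A) (F i - F j) ^+ 2.
  by apply: sumr_ge0 => i _; apply: sumr_ge0 => j _; rewrite sqr_ge0.
have e : \sum_(i in A) \sum_(j in A) (F i - F j) ^+ 2
   = 2 * (#|A|%:R * \sum_(i in A) F i ^+ 2) - 2 * (\sum_(i in A) F i) ^+ 2.
  transitivity (\sum_(i in A) (#|A|%:R * F i ^+ 2 + \sum_(j in A) F j ^+ 2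
                  - 2 * F i * \sum_(j in A) F j)).
    apply: eq_bigr => i _.
    rewrite mulr_natl -sumr_const mulr_sumr -big_split -sumrB /=.
    by apply: eq_bigr => j _; ring.
  rewrite sumrB big_split /= -mulr_sumr sumr_const -mulr_natl -mulr_suml -mulr_sumr.
  ring.
move: h; rewrite e; lra.
Qed.

Section LazySymmetricChain.
Variables (R : realType) (S : finType) (Q : S -> S -> R).
Hypothesis Q0 : forall x y, 0 <= Q x y.
Hypothesis Qsym : forall x y, Q x y = Q y x.
Hypothesis Q1 : forall x, \sum_y Q x y = 1.

Let P x y : R := 2^-1 * (x == y)%:R + 2^-1 * Q x y.

Definition markov_op (T : S -> S -> R) (f : S -> R) x := \sum_y T x y * f y.

Lemma sum_delta (f : S -> R) x :
  \sum_y (x == y)%:R * f y = f x.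
Proof.
rewrite (bigD1 x) //= eqxx mul1r big1 ?addr0 // => y yx.
by rewrite eq_sym (negbTE yx) mul0r.
Qed.

Lemma lazy_sym x y : P x y = P y x.
Proof. by rewrite /P Qsym eq_sym. Qed.

Lemma lazy_row x : \sum_y P x y = 1.
Proof.
rewrite /P big_split /= -!mulr_sumr Q1.
rewrite (_ : \sum_i (x == i)%:R = 1 :> R); first by field.
by rewrite -[RHS](sum_delta (fun=> 1) x); apply: eq_bigr => y _; rewrite mulr1.
Qed.

Lemma markov_op_lazy f x : markov_op P f x = 2^-1 * (f x + markov_op Q f x).
Proof.
rewrite /markov_op /P mulrDr -[in RHS](sum_delta f x) !mulr_sumr -big_split /=.
by apply: eq_bigr => y _; ring.
Qed.

(** Jensen's inequality in each row, obtained by expanding the nonnegative variance around the row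
    average [m]; the columns of [Q] sum to 1 by symmetry. *)
Lemma markov_op_contract f : \sum_x markov_op Q f x ^+ 2 <= \sum_x f x ^+ 2.
Proof.
rewrite [leRHS](_ : _ = \sum_x \sum_y Q x y * f y ^+ 2); last first.
  rewrite exchange_big /=; apply: eq_bigr => y _.
  by rewrite -mulr_suml; under eq_bigr do rewrite Qsym; rewrite Q1 mul1r.
apply: ler_sum => x _; have [m mE] : exists m, m = markov_op Q f x by exists (markov_op Q f x).
have: 0 <= \sum_y Q x y * (f y - m) ^+ 2.
  by apply: sumr_ge0 => y _; rewrite mulr_ge0 ?sqr_ge0.
have -> : \sum_y Q x y * (f y - m) ^+ 2 =
   \sum_y Q x y * f y ^+ 2 - 2 * m * markov_op Q f x + m ^+ 2 * \sum_y Q x y.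
  rewrite /markov_op !mulr_sumr -sumrB -big_split.
  by apply: eq_bigr => y _ /=; ring.
by rewrite Q1 -mE; lra.
Qed.

Lemma dirichletE f :
  \sum_x \sum_y P x y * (f x - f y) ^+ 2 =
  2 * (\sum_x f x ^+ 2 - \sum_x f x * markov_op P f x).
Proof.
transitivity (\sum_x (\sum_y P x y * f x ^+ 2) + \sum_x (\sum_y P x y * f y ^+ 2)
   - 2 * \sum_x f x * markov_op P f x).
  rewrite -big_split mulr_sumr -sumrB; apply: eq_bigr => x _ /=.
  rewrite /markov_op mulr_sumr mulr_sumr -big_split -sumrB.
  by apply: eq_bigr => y _ /=; ring.
rewrite [X in _ + X - _]exchange_big /=.
have e : \sum_x (\sum_y P x y * f x ^+ 2) = \sum_x f x ^+ 2.
  by apply: eq_bigr => x _; rewrite -mulr_suml lazy_row mul1r.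
rewrite e; under [X in _ + X - _]eq_bigr do under eq_bigr do rewrite lazy_sym.
rewrite e; ring.
Qed.

(* Laziness makes P positive semi-definite, so that |Pf|^2 <= <f, Pf>. *)
Lemma lazy_energy_decay f :
  \sum_x markov_op P f x ^+ 2 <=
  \sum_x f x ^+ 2 - 2^-1 * \sum_x \sum_y P x y * (f x - f y) ^+ 2.
Proof.
rewrite dirichletE mulrA mulVf ?pnatr_eq0 // mul1r opprB addrC subrK.
have := markov_op_contract f.
have -> : \sum_x f x * markov_op P f x =
   2^-1 * (\sum_x f x ^+ 2 + \sum_x f x * markov_op Q f x).
  rewrite -big_split mulr_sumr; apply: eq_bigr => x _ /=.
  by rewrite markov_op_lazy; ring.
have -> : \sum_x markov_op P f x ^+ 2 =
   4^-1 * (\sum_x f x ^+ 2 + 2 * (\sum_x f x * markov_op Q f x)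
           + \sum_x markov_op Q f x ^+ 2).
  rewrite mulr_sumr -!big_split mulr_sumr; apply: eq_bigr => x _ /=.
  by rewrite markov_op_lazy; field.
lra.
Qed.

Lemma trans_pow_succr t x y :
  trans_pow P t.+1 x y = \sum_z trans_pow P t x z * P z y.
Proof.
elim: t x => [|t IH] x /=.
  rewrite sum_delta (bigD1 y) //= eqxx mulr1 big1 ?addr0 // => z /negbTE ->.
  by rewrite mulr0.
transitivity (\sum_z P x z * \sum_w trans_pow P t z w * P w y).
  by apply: eq_bigr => z _; rewrite -IH.
transitivity (\sum_z \sum_w P x z * (trans_pow P t z w * P w y)).
  by apply: eq_bigr => z _; rewrite mulr_sumr.
rewrite exchange_big; apply: eq_bigr => w _; rewrite mulr_suml.
by apply: eq_bigr => z _; rewrite mulrA.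
Qed.

Lemma trans_pow_sym t x y : trans_pow P t x y = trans_pow P t y x.
Proof.
elim: t x y => [|t IH] x y; first by rewrite /= eq_sym.
rewrite trans_pow_succr /=; apply: eq_bigr => z _.
by rewrite IH lazy_sym mulrC.
Qed.

Lemma trans_pow_col t y : \sum_x trans_pow P t x y = 1.
Proof.
elim: t => [|t IH] /=.
  rewrite -[RHS](sum_delta (fun=> 1) y); apply: eq_bigr => x _.
  by rewrite mulr1 eq_sym.
rewrite exchange_big /= -[RHS]IH; apply: eq_bigr => z _.
rewrite -mulr_suml; under eq_bigr do rewrite lazy_sym.
by rewrite lazy_row mul1r.
Qed.

Variable gap : R.
Hypothesis gap01 : 0 < gap <= 1.
Hypothesis poincare : forall f : S -> R, \sum_x f x = 0 ->
  gap * \sum_x f x ^+ 2 <= 2^-1 * \sum_x \sum_y P x y * (f x - f y) ^+ 2.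

(** By symmetry, row [x] of the [t]-th power is also its column [x]. One more step therefore applies
    [P] to the mean-zero function [h], to which the Poincare inequality applies. At time 0 the sum
    equals [1 - #|S|^-1]. *)
Lemma l2_decay t x : \sum_y (trans_pow P t x y - #|S|%:R^-1) ^+ 2 <= (1 - gap) ^+ t.
Proof.
have N0 : #|S|%:R != 0 :> R by rewrite pnatr_eq0 -lt0n; apply/card_gt0P; exists x.
under eq_bigr do rewrite trans_pow_sym.
elim: t => [|t IH].
  have -> : \sum_y (trans_pow P 0 y x - #|S|%:R^-1) ^+ 2 =
     \sum_y ((x == y)%:R * 1 - 2 * #|S|%:R^-1 * ((x == y)%:R * 1) + #|S|%:R^-1 ^+ 2).
    by apply: eq_bigr => y _ /=; rewrite eq_sym; case: (_ == _) => /=; ring.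
  rewrite big_split sumrB -mulr_sumr !(sum_delta (fun=> 1)) sumr_const /=.
  have -> : (#|S|%:R^-1 : R) ^+ 2 *+ #|S| = #|S|%:R^-1.
    by rewrite -mulr_natl expr2 mulrA divff // mul1r.
  have : 0 <= (#|S|%:R^-1 : R) by rewrite invr_ge0 ler0n.
  rewrite expr0; lra.
rewrite exprS; pose h y := trans_pow P t y x - #|S|%:R^-1.
have h0 : \sum_y h y = 0.
  by rewrite /h sumrB trans_pow_col sumr_const -[X in _ - X]mulr_natl divff // subrr.
have hS y : trans_pow P t.+1 y x - #|S|%:R^-1 = markov_op P h y.
  rewrite /= /markov_op /h; under [RHS]eq_bigr do rewrite mulrBr.
  by rewrite sumrB -[in RHS]mulr_suml lazy_row mul1r.
under eq_bigr do rewrite hS.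
apply: le_trans (lazy_energy_decay h) _.
have := poincare h0.
have : (1 - gap) * \sum_y h y ^+ 2 <= (1 - gap) * (1 - gap) ^+ t.
  by apply: ler_wpM2l => //; case/andP: gap01; lra.
lra.
Qed.

(** Cauchy-Schwarz on each event [A], with [#|A| <= #|S|]. *)
Lemma dTV_decay t x :
  dTV (trans_pow P t x) (@uniform_dist R S) ^+ 2 <= #|S|%:R * (1 - gap) ^+ t.
Proof.
have B0 : 0 <= #|S|%:R * (1 - gap) ^+ t.
  by rewrite mulr_ge0 ?ler0n ?exprn_ge0 //; case/andP: gap01; lra.
have d0 : 0 <= dTV (trans_pow P t x) (@uniform_dist R S).
  by rewrite /dTV; exact: bigmax_ge_id.
rewrite -(sqr_sqrtr B0) ler_pXn2r ?nnegrE ?sqrtr_ge0 //.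
rewrite /dTV; apply: bigmax_le => [|A _]; first exact: sqrtr_ge0.
rewrite -sumrB -sqrtr_sqr ler_wsqrtr //.
apply: le_trans (sqr_sum_le _ _) _.
apply: ler_pM => //; first by apply: sumr_ge0 => y _; rewrite sqr_ge0.
  by rewrite ler_nat max_card.
apply: le_trans (l2_decay t x).
rewrite big_mkcond; apply: ler_sum => y _; case: ifP => _ //; exact: sqr_ge0.
Qed.

Lemma mixing_time_le (t0 : nat) (delta : R) : 0 < delta -> (0 < #|S|)%N ->
  ln #|S|%:R + 2 * ln delta^-1 <= gap * t0%:R ->
  (mixing_time P (@uniform_dist R S) delta <= t0%:R%:E)%E.
Proof.
move=> d0 S0 Ht0; rewrite /mixing_time; apply: bigmax_le => [|x _]; first exact: leNye.
apply: ereal_inf_lbound; exists t0 => // t t0t /=.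
case/andP: gap01 => g0 g1.
have N0 : 0 < #|S|%:R :> R by rewrite ltr0n.
have dt0 : 0 <= dTV (trans_pow P t x) (@uniform_dist R S).
  by rewrite /dTV; exact: bigmax_ge_id.
rewrite -(@ler_pXn2r _ 2) ?nnegrE // ?(ltW d0) //.
apply: le_trans (dTV_decay t x) _.
have h1 : (1 - gap) ^+ t <= expR (- (gap * t%:R)).
  rewrite -mulNr mulrC expRM_natl lerXn2r ?nnegrE ?expR_ge0 ?subr_ge0 //.
  by rewrite -[leLHS]/(1 + - gap) expR_ge1Dx.
apply: (@le_trans _ _ (#|S|%:R * expR (- (gap * t%:R)))); first by rewrite ler_wpM2l // ltW.
rewrite -[X in X * _]lnK ?posrE // -expRD -[delta in leRHS]lnK ?posrE //.
rewrite -expRM_natl ler_expR.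
have : gap * t0%:R <= gap * t%:R by rewrite ler_wpM2l ?ler_nat // ltW.
by move: Ht0; rewrite lnV ?posrE //; lra.
Qed.

End LazySymmetricChain.

(** * Elimination orders from path decompositions *)

Section EliminationOrder.
Variable G : sgraph.
Implicit Types A D U E F X : {set G}.

Definition bd A : {set G} := [set w | (w \notin A) && [exists a in A, edge a w]].

Lemma bdP A w : reflect (w \notin A /\ exists2 a, a \in A & edge a w) (w \in bd A).
Proof.
rewrite inE; apply: (iffP andP) => -[wA].
  by case/existsP=> a /andP[]; split=> //; exists a.
by case=> a aA aw; split=> //; apply/existsP; exists a; rewrite aA.
Qed.

Lemma bag_width (X : seq {set G}) B : B \in X -> (#|B|.-1 <= pd_width X)%N.
Proof.
by move=> BX; rewrite /pd_width -!subn1 leq_sub2r //; exact: (leq_bigmax_seq B).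
Qed.

(** The vertices are sorted by the last bag that contains them. If [u] ends an initial segment and
    [w] is an outer neighbor of some [a] in it, then a bag shared by [a] and [w] comes no later than
    the last bag of [u], which comes no later than the last bag of [w]. By the interval property,
    [w] lies in the last bag of [u]. *)
Lemma elimination_order : exists o : seq G,
  [/\ uniq o, forall v, v \in o
    & forall i, (#|bd [set x in take i o]| <= pathwidth G)%N].
Proof.
rewrite /pathwidth; case: ex_minnP => p /asboolP[X [Xv Xe Xi] <-] _.
pose l v := (\max_(i < size X | v \in nth finset.set0 X i) i)%N.
have lP v : (l v < size X)%N /\ v \in nth finset.set0 X (l v).
  have [B BX vB] := Xv v.
  have hi : (index B X < size X)%N by rewrite index_mem.
  have vi : v \in nth finset.set0 X (Ordinal hi) by rewrite nth_index.
  by rewrite /l (bigop.bigmax_eq_arg (Ordinal hi)) //; case: arg_maxnP => // j vj _.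
have l_max v i : (i < size X)%N -> v \in nth finset.set0 X i -> (i <= l v)%N.
  by move=> hi vi; exact: (leq_bigmax_cond (Ordinal hi)).
pose r := [rel a b : G | (l a <= l b)%N].
have r_tr : ssrbool.transitive r by move=> b a c /=; apply: leq_trans.
pose o := sort r (enum G).
exists o; split=> [|v|i]; rewrite ?sort_uniq ?enum_uniq ?mem_sort ?mem_enum //.
have : pairwise r o.
  by rewrite -sorted_pairwise // sort_sorted // => a b /=; apply: leq_total.
have o_all v : v \in o by rewrite mem_sort mem_enum.
move: o_all; rewrite -{1 2}(cat_take_drop i o) pairwise_cat.
case/lastP: (take i o) => [|s u] o_all.
  rewrite (_ : bd _ = finset.set0) ?cards0 //; apply/setP => w.
  by rewrite !inE; apply/negbTE/existsP => -[a]; rewrite inE.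
case/and3P => /allrelP su_d; rewrite pairwise_rcons => /andP[/allP s_u _] _.
set A := [set x in rcons s u].
have uA : u \in A by rewrite inE mem_rcons in_cons eqxx.
have [lu uX] := lP u.
apply: leq_trans (bag_width (mem_nth finset.set0 lu)).
(* The vertex [u] is in its own last bag but not in the boundary, which accounts for the -1 in the
   width. *)
rewrite [X in (_ <= X.-1)%N](cardsD1 u) uX add1n /= subset_leq_card //.
apply/fintype.subsetP => w /bdP[wA [a aA aw]].
rewrite !inE; apply/andP; split; first by apply: contraNneq wA => ->.
have la : (l a <= l u)%N.
  by move: aA; rewrite inE mem_rcons in_cons => /predU1P[-> //|/s_u].
have lw : (l u <= l w)%N.
  apply: su_d; first by rewrite mem_rcons in_cons eqxx.
  by have := o_all w; rewrite mem_cat; move: wA; rewrite inE => /negbTE ->.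
have [B BX /andP[aB wB]] := Xe a w aw.
have hB : (index B X < size X)%N by rewrite index_mem.
have Ba : (index B X <= l a)%N by apply: l_max => //; rewrite nth_index.
have [lw' wX] := lP w.
have Blw : (index B X <= l u <= l w)%N by rewrite (leq_trans Ba la) lw.
by apply: (fintype.subsetP (Xi _ _ _ Blw lw')); rewrite inE nth_index // wB wX.
Qed.

Lemma pathwidth_gt0 (u v : G) : edge u v -> (0 < pathwidth G)%N.
Proof.
rewrite /pathwidth; case: ex_minnP => p /asboolP[X [Xv Xe _] <-] _ uv.
have [B BX /andP[uB vB]] := Xe u v uv.
apply: leq_trans (bag_width BX).
rewrite -subn1 subn_gt0; apply/card_gt1P; exists u, v; split=> //.
by apply: contraTneq uv => ->; rewrite edge_irr.
Qed.

Lemma pathwidth_le : (pathwidth G <= #|G|)%N.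
Proof.
rewrite /pathwidth; case: ex_minnP => p _ pmin.
apply: leq_trans (pmin #|G|.-1 _) (leq_pred _).
apply/asboolP; exists [:: [set: G]]; last by rewrite /pd_width big_seq1 cardsT.
split.
- by move=> v; exists [set: G]; rewrite ?inE.
- by move=> u v _; exists [set: G]; rewrite ?inE.
- move=> i j l /andP[ij jl]; rewrite /= ltnS leqn0 => /eqP l0.
  by move: jl; rewrite l0 leqn0 => /eqP ->; rewrite finset.subsetIr.
Qed.

End EliminationOrder.

(** * Random paths between proper colorings *)

Section RandomPath.
Variables (G : sgraph) (k q : nat).
Local Notation col := {ffun G -> 'I_k}.
Implicit Types (A D U E F X : {set G}) (s t z : col) (pr : seq (bool * G)).

(** * Available colors and greedy extensions *)

Definition avail z w : {set 'I_k} :=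
  [set c | [forall u, edge w u ==> (z u != c)]].

Hypothesis q_gt0 : (0 < q)%N.
Hypothesis q_avail : forall z w, (q <= #|avail z w|)%N.

Definition agree X s : {set col} := [set z : col | [forall (x | x \in X), z x == s x]].

Lemma agreeP X s z : reflect {in X, forall x, z x = s x} (z \in agree X s).
Proof.
rewrite inE; apply: (iffP forall_inP) => h x xX; first exact/eqP/h.
by apply/eqP/h.
Qed.

Lemma proper_coloringP s : reflect (forall x y, ~~ monochromatic s x y) (proper_coloring s).
Proof.
rewrite /proper_coloring negb_exists; apply: (iffP forallP) => h x.
  by have := h x; rewrite negb_exists => /forallP.
by rewrite negb_exists; apply/forallP.
Qed.

Lemma monochromatic_sym s x y : monochromatic s x y = monochromatic s y x.
Proof. by rewrite /monochromatic edge_sym eq_sym. Qed.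

Lemma sf_stateP s u : (forall x y, monochromatic s x y -> (u == x) || (u == y)) ->
  proper_coloring s || singly_flawed s.
Proof.
move=> h; rewrite /proper_coloring /singly_flawed; case: existsP => //= -[x sx].
apply/existsP; exists u; apply/forallP=> a; apply/forallP=> b; apply/implyP.
exact: h.
Qed.

Lemma recolorE z w c x : recolor z w c x = if x == w then c else z x.
Proof. by rewrite ffunE. Qed.

Lemma recolor_eq z w c : recolor z w c w = c.
Proof. by rewrite recolorE eqxx. Qed.

Lemma recolor_neq z w c x : x != w -> recolor z w c x = z x.
Proof. by rewrite recolorE => /negbTE ->. Qed.

Lemma card_agreeC X s : (#|agree (~: X) s| <= k ^ #|X|)%N.
Proof.
pose f z : {ffun {x | x \in X} -> 'I_k} := [ffun x => z (val x)].
have -> : (k ^ #|X|)%N = #|{ffun {x | x \in X} -> 'I_k}|.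
  by rewrite card_ffun card_ord card_sig; congr (k ^ _)%N; apply: eq_card => x; rewrite inE.
apply: (@leq_card_in _ _ f) => z t /agreeP zs /agreeP ts zt.
apply/ffunP => x; case: (boolP (x \in X)) => xX.
  by have /ffunP/(_ (Sub x xX)) := zt; rewrite !ffunE SubK.
by rewrite zs ?ts ?inE.
Qed.

Lemma card_partition_color (B : {set col}) w :
  #|B| = (\sum_c #|[set z in B | z w == c]|)%N.
Proof.
rewrite -sum1_card (partition_big (fun z : col => z w) xpredT) //=.
apply: eq_bigr => c _; rewrite sum1_card; apply: eq_card => z.
by rewrite [RHS]inE.
Qed.

(** The vertices of [F] are recolored greedily one at a time: [w] has at least [q] colors avoiding
    the current colors of all its neighbors, different choices give extensions that differ at [w],
    and the hypothesis survives for [F :\ w]. *)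
Lemma card_extensions F s :
  (forall x y, x \notin F -> y \notin F -> ~~ monochromatic s x y) ->
  (q ^ #|F| <= #|[set z in agree (~: F) s | proper_coloring z]|)%N.
Proof.
have [n leFn] := ubnP #|F|.
elim: n F leFn s => // n IH F /ltnSE leFn s sF.
have [F0|[w wF]] := set_0Vmem F.
  rewrite F0 cards0 expn0; apply/card_gt0P; exists s; rewrite inE.
  apply/andP; split; first by apply/agreeP.
  by apply/proper_coloringP => x y; apply: sF; rewrite F0 inE.
rewrite (cardsD1 w) wF add1n expnS (card_partition_color _ w).
apply: (@leq_trans (\sum_(c in avail s w) q ^ #|F :\ w|)%N).
  by rewrite sum_nat_const leq_mul2r q_avail orbT.
rewrite [leqRHS](bigID (mem (avail s w))) /=; apply: leq_trans (leq_addr _ _).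
apply: leq_sum => c; rewrite inE => /forallP cw.
have F'n : (#|F :\ w| < n)%N.
  by apply: leq_trans leFn; rewrite [X in (_ < X)%N](cardsD1 w) wF.
apply: leq_trans (IH _ F'n (recolor s w c) _) _.
  move=> x y; rewrite !in_setD1 !negb_and !negbK /monochromatic !recolorE.
  case: (eqVneq x w) => [->|xw]; case: (eqVneq y w) => [->|yw] /= xF yF.
  - by rewrite edge_irr.
  - by have := cw y; case: edge => //=; rewrite eq_sym.
  - by have := cw x; rewrite edge_sym; case: edge.
  - by rewrite -negb_and; apply: sF.
apply: subset_leq_card; apply/fintype.subsetP => z.
rewrite finset.in_set => /andP[/agreeP zs pz].
have wz : z w = c by rewrite zs ?recolor_eq // !inE eqxx.
rewrite finset.in_set wz eqxx andbT finset.in_set pz andbT; apply/agreeP => x xF; rewrite zs.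
  by rewrite recolor_neq //; apply: contraTneq xF => ->; rewrite inE negbK.
by move: xF; rewrite !inE negb_and => ->; rewrite orbT.
Qed.

(* The default z w is never reached: q_avail leaves at least q choices. *)
Definition pick_color z w (c : 'I_q) : 'I_k := nth (z w) (enum (avail z w)) c.

Lemma pick_color_avail z w c u : edge w u -> pick_color z w c != z u.
Proof.
move=> wu; have : pick_color z w c \in enum (avail z w).
  by rewrite mem_nth // -cardE (leq_trans (ltn_ord c)).
by rewrite mem_enum inE => /forallP/(_ u); rewrite wu eq_sym.
Qed.

Lemma pick_color_inj z w : injective (pick_color z w).
Proof.
have c_lt (c : 'I_q) : (c < size (enum (avail z w)))%N.
  by rewrite -cardE (leq_trans (ltn_ord c)).
by move=> c d /eqP; rewrite /pick_color nth_uniq ?enum_uniq // => /eqP/val_inj.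
Qed.

(* Instruction (true, u) gives u its final color; (false, w) gives w a random *)
(* one. The choice c is ignored in the first case, but still drawn so that    *)
(* all lists of outcomes after l instructions have size q ^ l.                *)
Definition path_step t (i : bool * G) z (c : 'I_q) : col :=
  recolor z i.2 (if i.1 then t i.2 else pick_color z i.2 c).

Definition outcomes s t pr : seq col :=
  foldl (fun l i => [seq path_step t i z c | z <- l, c <- enum 'I_q]) [:: s] pr.

Lemma outcomes_rcons s t pr i :
  outcomes s t (rcons pr i) =
  [seq path_step t i z c | z <- outcomes s t pr, c <- enum 'I_q].
Proof. by rewrite /outcomes foldl_rcons. Qed.

Lemma size_outcomes s t pr : size (outcomes s t pr) = (q ^ size pr)%N.
Proof.
elim/last_ind: pr => // pr i IH.
by rewrite outcomes_rcons size_allpairs IH size_enum_ord size_rcons expnSr.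
Qed.

Lemma count_outcomes_rcons s t pr i (a : pred col) :
  count a (outcomes s t (rcons pr i)) =
  (\sum_(z <- outcomes s t pr) #|[pred c | a (path_step t i z c)]|)%N.
Proof.
rewrite outcomes_rcons -sum1_count big_mkcond big_allpairs_dep.
by apply: eq_bigr => z _; rewrite -big_mkcond big_enum_cond /= sum1_card.
Qed.

(** For an event that the step does not affect: each outcome has [q] successors, all on the same
    side of [B], so the probability is unchanged. *)
Lemma count_outcomes_invar s t pr i (B : {set col}) :
  (forall z c, (path_step t i z c \in B) = (z \in B)) ->
  count (mem B) (outcomes s t (rcons pr i)) = (count (mem B) (outcomes s t pr) * q)%N.
Proof.
move=> Bi; rewrite count_outcomes_rcons -sum1_count big_distrl [RHS]big_mkcond.
apply: eq_bigr => z _ /=; case: ifP => zB.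
  rewrite mul1n eq_cardT => [|c]; last exact: etrans (Bi z c) zB.
  by rewrite -cardE card_ord.
by rewrite eq_card0 // => c; exact: etrans (Bi z c) zB.
Qed.

(* The state of the random path from s to t after the instructions pr: A is   *)
(* already colored by t, D has been recolored at random, and only edges from  *)
(* u to the not yet updated neighbors U of u may be monochromatic.            *)
Record path_inv pr A D (u : G) U : Prop := PathInv {
  inv_bd : forall x y, x \in A -> edge x y -> y \notin A ->
    y \in D \/ x = u /\ y \in U;
  inv_sub : forall y, (y \in D) || (y \in U) -> y \in bd A;
  inv_val : forall s t, proper_coloring s -> proper_coloring t ->
    forall z, z \in outcomes s t pr ->
    [/\ {in A, forall x, z x = t x},
        forall x, x \notin A -> x \notin D -> z x = s x
      & forall x y, monochromatic z x y -> (x = u /\ y \in U) \/ (y = u /\ x \in U)];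
  inv_count : forall s t E a, E \subset D ->
    (count (mem (agree E a)) (outcomes s t pr) * q ^ #|E| <= q ^ size pr)%N }.

Lemma path_inv_nil u : path_inv [::] finset.set0 finset.set0 u finset.set0.
Proof.
split=> [x y|y|s t ps pt z|s t E a].
- by rewrite inE.
- by rewrite !inE.
- rewrite inE => /eqP ->; split=> [x|//|x y]; first by rewrite inE.
  by rewrite (negbTE (proper_coloringP s ps x y)).
- rewrite finset.subset0 => /eqP ->; rewrite cards0 muln1 expn0 /=.
  by rewrite addn0 leq_b1.
Qed.

(** The color [t u] cannot clash inside [A], where the coloring already equals the proper coloring
    [t]. All clashes are with neighbors outside [A]; these form the new [U], including those already
    in [D], which will be recolored again. The color of [u] is now final, so [u] leaves [D]. *)
Lemma path_inv_fix pr A D u' u : path_inv pr A D u' finset.set0 -> u \notin A ->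
  path_inv (rcons pr (true, u)) (u |: A) (D :\ u) u [set y | edge u y & y \notin A].
Proof.
move=> inv uA; split=> [x y|y|s t ps pt z'|s t E a].
- rewrite !inE negb_or => /predU1P[->|xA] xy /andP[yu yA]; first by right; rewrite xy.
  left; rewrite yu /=.
  by case: (inv_bd inv xA xy yA) => // -[_]; rewrite inE.
- rewrite !inE => /orP[/andP[yu yD]|/andP[uy yA]].
    have /bdP[yA [a aA ay]] : y \in bd A by apply: (inv_sub inv); rewrite yD.
    rewrite negb_or yu yA; apply/existsP; exists a.
    by rewrite !inE aA orbT.
  have yu : y != u by apply: contraTneq uy => ->; rewrite edge_irr.
  rewrite negb_or yu yA; apply/existsP; exists u.
  by rewrite !inE eqxx.
- rewrite outcomes_rcons => /allpairsP[[z c] [/= zo _ ->]].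
  have [zA zS zm] := inv_val inv ps pt zo; rewrite /path_step /=.
  split=> [x|x|x y].
  + rewrite !inE => /predU1P[->|xA]; first by rewrite recolor_eq.
    by rewrite recolor_neq ?zA //; apply: contraNneq uA => <-.
  + rewrite !inE negb_or => /andP[xu xA]; rewrite xu /= => xD.
    by rewrite recolor_neq // zS.
  + have mono_u y' : monochromatic (recolor z u (t u)) u y' ->
        y' \in [set y | edge u y & y \notin A].
      rewrite /monochromatic recolor_eq => /andP[uy'].
      have y'u : y' != u by apply: contraTneq uy' => ->; rewrite edge_irr.
      rewrite recolor_neq // inE uy' /= => tu; apply/negP => y'A.
      by have /proper_coloringP/(_ u y') := pt; rewrite /monochromatic uy' -(zA _ y'A) tu.
    have [->|xu] := eqVneq x u; first by move/mono_u; left.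
    have [->|yu] := eqVneq y u.
      by rewrite monochromatic_sym => /mono_u; right.
    rewrite /monochromatic !recolor_neq // => /zm.
    by rewrite !inE => -[] [].
- move=> ED; rewrite size_rcons expnSr.
  have uE : u \notin E.
    by apply/negP => /(fintype.subsetP ED); rewrite !inE eqxx.
  have EA z c : (path_step t (true, u) z c \in agree E a) = (z \in agree E a).
    rewrite /path_step !inE; apply: eq_forallb_in => x xE; rewrite recolor_neq //=.
    by apply: contraNneq uE => <-.
  rewrite (count_outcomes_invar s pr EA).
  rewrite mulnAC leq_mul2r (inv_count inv) ?orbT //.
  by apply: fintype.subset_trans ED _; apply: subsetDl.
Qed.

(** An available color creates no monochromatic edge at [w], so [w] leaves [U]. Since [pick_color]
    is injective, at most one of the [q] choices produces the prescribed color [a w]; this gives the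
    extra factor [q^-1] when [w] joins [D]. *)
Lemma path_inv_rand pr A D u U w : path_inv pr A D u U -> w \in U ->
  path_inv (rcons pr (false, w)) A (w |: D) u (U :\ w).
Proof.
move=> inv wU; have /bdP[wA _] : w \in bd A by apply: (inv_sub inv); rewrite wU orbT.
split=> [x y xA xy yA|y|s t ps pt z'|s t E a].
- rewrite !inE; have [->|yw] := eqVneq y w; first by left.
  by case: (inv_bd inv xA xy yA) => [|[-> yU]]; [left|right].
- rewrite !inE => h; have := inv_sub inv (y := y); rewrite inE; apply.
  by case/orP: h => [/predU1P[->|->]|/andP[_ ->]]; rewrite ?wU ?orbT.
- rewrite outcomes_rcons => /allpairsP[[z c] [/= zo _ ->]].
  have [zA zS zm] := inv_val inv ps pt zo; rewrite /path_step /=.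
  split=> [x xA|x xA|x y].
  + by rewrite recolor_neq ?zA //; apply: contraNneq wA => <-.
  + rewrite !inE negb_or => /andP[xw xD].
    by rewrite recolor_neq // zS.
  + have no_w y' : ~~ monochromatic (recolor z w (pick_color z w c)) w y'.
      rewrite /monochromatic; case: (boolP (edge w y')) => //= wy'.
      have y'w : y' != w by apply: contraTneq wy' => ->; rewrite edge_irr.
      by rewrite recolor_eq recolor_neq // pick_color_avail.
    have [->|xw] := eqVneq x w; first by rewrite (negbTE (no_w _)).
    have [->|yw] := eqVneq y w.
      by rewrite monochromatic_sym (negbTE (no_w _)).
    by rewrite /monochromatic !recolor_neq // !inE xw yw => /zm.
- move=> ED; rewrite size_rcons expnSr.
  have E'D : E :\ w \subset D.
    apply/fintype.subsetP => x; rewrite !inE => /andP[xw /(fintype.subsetP ED)].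
    by rewrite !inE (negbTE xw).
  have [wE|wE] := boolP (w \in E).
    rewrite (cardsD1 w) wE add1n expnS mulnCA mulnC leq_mul2r; apply/orP; right.
    apply: leq_trans (inv_count inv s t a E'D).
    rewrite leq_mul2r; apply/orP; right.
    rewrite count_outcomes_rcons -sum1_count [X in (_ <= X)%N]big_mkcond; apply: leq_sum => z _ /=.
    case: ifP => zE.
      apply/card_le1_eqP => c d; rewrite !inE => /forall_inP/(_ _ wE)/eqP cE.
      move=> /forall_inP/(_ _ wE)/eqP; rewrite -cE /path_step /= !recolor_eq.
      by move=> h; apply: (@pick_color_inj z w).
    rewrite eq_card0 // => c; rewrite inE /=; apply/negP => /agreeP h.
    move/negP: zE; apply; apply/agreeP => x; rewrite !inE => /andP[xw xE].
    by rewrite -(h _ xE) recolor_neq.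
  have EA z c : (path_step t (false, w) z c \in agree E a) = (z \in agree E a).
    rewrite /path_step !inE; apply: eq_forallb_in => x xE; rewrite recolor_neq //=.
    by apply: contraNneq wE => <-.
  rewrite (count_outcomes_invar s pr EA).
  rewrite mulnAC leq_mul2r (inv_count inv) ?orbT //.
  apply/fintype.subsetP => x xE; apply: (fintype.subsetP E'D).
  by rewrite !inE xE andbT; apply: contraNneq wE => <-.
Qed.

Definition proper_set : {set col} := [set s | proper_coloring s].

(* A pair (s, t) whose path visits a is encoded by a proper coloring that is  *)
(* s on A minus u and t off A and D, and free on F; then s and t are known    *)
(* off F and off D respectively.                                              *)
Lemma count_visits pr A D u U F a : path_inv pr A D u U ->
  F = (A :|: D) :\: (A :\ u) ->
  (\sum_(s in proper_set) \sum_(t in proper_set) count_mem a (outcomes s t pr)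
     * q ^ (#|F| + #|D|) <= q ^ size pr * (#|proper_set| * k ^ (#|F| + #|D|)))%N.
Proof.
move=> inv defF.
have FE x : (x \notin F) = (x \in A :\ u) || (x \notin A) && (x \notin D).
  by rewrite defF !inE negb_and negbK negb_or.
pose b1 y : col := [ffun x => if x \in A :\ u then y x else a x].
pose b2 y : col := [ffun x => if x \in A then a x else y x].
have key s t : s \in proper_set -> t \in proper_set ->
    (count_mem a (outcomes s t pr) * q ^ (#|F| + #|D|) <= q ^ size pr *
     \sum_(y in proper_set) ((s \in agree (~: F) (b1 y)) * (t \in agree (~: D) (b2 y))))%N.
  rewrite !inE => ps pt.
  have [ao|/count_memPn ->] := boolP (a \in outcomes s t pr); last by rewrite mul0n.
  have [aA aS _] := inv_val inv ps pt ao.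
  (* The factor [q ^ #|D|] is paid by the randomness of the path ([inv_count] with [E = D]), and
     [q ^ #|F|] by the number of hybrids [y] that encode this pair. *)
  rewrite expnD mulnCA mulnC; apply: leq_mul.
    apply: leq_trans (inv_count inv s t a (fintype.subxx D)).
    by rewrite leq_mul2r; apply/orP; right; apply: sub_count => z /= /eqP ->; apply/agreeP.
  pose base : col := [ffun x => if x \in A :\ u then s x else t x].
  apply: leq_trans (card_extensions (F := F) (s := base) _) _.
    (* By [inv_bd], an edge leaving [A :\ u] ends in [D], so off [F] no edge joins the [s] part of
       [base] to its [t] part. *)
    have edgeAD x y : x \in A :\ u -> y \notin A -> y \notin D -> ~~ edge x y.
      rewrite inE !inE => /andP[xu xA] yA yD; apply/negP => xy.
      case: (inv_bd inv xA xy yA) => [yD'|[xu' _]]; first by rewrite yD' in yD.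
      by rewrite xu' eqxx in xu.
    move=> x y; rewrite !FE /monochromatic !ffunE.
    case: (boolP (x \in A :\ u)) => xA /=; case: (boolP (y \in A :\ u)) => yA /=.
    - by move=> _ _; exact: (proper_coloringP _ ps).
    - by move=> _ /andP[yA' yD]; rewrite (negbTE (edgeAD _ _ xA yA' yD)).
    - move=> /andP[xA' xD] _; rewrite edge_sym.
      by rewrite (negbTE (edgeAD _ _ yA xA' xD)).
    - by move=> _ _; exact: (proper_coloringP _ pt).
  rewrite -sum1_card [leqRHS]big_mkcond [leqLHS]big_mkcond; apply: leq_sum => y _.
  rewrite finset.in_set [in leqRHS]finset.in_set; case: (boolP (y \in agree _ _)) => //= /agreeP yb.
  case: (proper_coloring y) => //.
  have -> : s \in agree (~: F) (b1 y).
    apply/agreeP => x xF; move: (yb _ xF); move: xF; rewrite finset.in_setC FE !ffunE.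
    by case: (x \in A :\ u) => //= /andP[xA xD] _; rewrite aS.
  have -> // : t \in agree (~: D) (b2 y).
  apply/agreeP => x; rewrite finset.in_setC !ffunE => xD.
  case: (boolP (x \in A)) => xA; first by rewrite aA.
  rewrite yb ?finset.in_setC ?FE ?xA ?xD ?orbT // ffunE.
  by rewrite !inE (negbTE xA) andbF.
apply: (@leq_trans (\sum_(s in proper_set) \sum_(t in proper_set) q ^ size pr *
     \sum_(y in proper_set) ((s \in agree (~: F) (b1 y)) * (t \in agree (~: D) (b2 y))))%N).
  by apply: leq_sum => s ps; apply: leq_sum => t pt; exact: key.
under eq_bigr do rewrite -big_distrr /=.
rewrite -big_distrr /= leq_mul2l; apply/orP; right.
under eq_bigr do rewrite exchange_big /=.
rewrite exchange_big /= -sum_nat_const; apply: leq_sum => y _.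
under eq_bigr do rewrite -big_distrr /=.
(* Given the hybrid [y], the coloring [s] is free only on [F] and [t] only on [D]. *)
rewrite -big_distrl /= expnD; apply: leq_mul.
  apply: leq_trans (card_agreeC F (b1 y)).
  rewrite -sum1_card big_mkcond [leqRHS]big_mkcond /=; apply: leq_sum => s _.
  by case: ifP => _ //; case: (s \in _).
apply: leq_trans (card_agreeC D (b2 y)).
rewrite -sum1_card big_mkcond [leqRHS]big_mkcond /=; apply: leq_sum => t _.
by case: ifP => _ //; case: (t \in _).
Qed.

(** * Congestion and energy along the random paths *)

Variables (R : realType) (p : nat).
Hypothesis qk : (q <= k)%N.

Local Notation H := (k%:R / q%:R : R).
Local Notation visit_bound := (#|proper_set|%:R * H ^+ (2 * p + 1)).

Lemma H_ge1 : 1 <= H.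
Proof. by rewrite ler_pdivlMr ?ltr0n // mul1r ler_nat. Qed.

Lemma visit_bound_ge0 : 0 <= visit_bound.
Proof. by rewrite mulr_ge0 ?ler0n // exprn_ge0 // (le_trans ler01 H_ge1). Qed.

(** Here [F] is contained in [u |: D], so [#|F| + #|D| <= 2 * p + 1], and [H >= 1] allows the
    exponent to be raised to this value. *)
Lemma count_visits_le pr A D u U a : path_inv pr A D u U -> (#|D| <= p)%N ->
  \sum_(s in proper_set) \sum_(t in proper_set)
     (count_mem a (outcomes s t pr))%:R / q%:R ^+ size pr <= visit_bound.
Proof.
move=> inv Dp; have := count_visits a inv erefl; set F := (_ :\: _) => cv.
have Fp : (#|F| <= #|D|.+1)%N.
  apply: (@leq_trans #|u |: D|); last by rewrite cardsU1; case: (u \in D).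
  apply: subset_leq_card; apply/fintype.subsetP => x.
  by rewrite !inE; case: (x == u) => //=; case: (x \in A).
have q0 : 0 < q%:R :> R by rewrite ltr0n.
apply: (@le_trans _ _ (#|proper_set|%:R * H ^+ (#|F| + #|D|))); last first.
  rewrite ler_wpM2l ?ler0n // ler_weXn2l ?H_ge1 //.
  by move: Fp Dp; lia.
under eq_bigr do rewrite -mulr_suml -natr_sum.
rewrite -mulr_suml -natr_sum ler_pdivrMr ?exprn_gt0 //.
rewrite expr_div_n mulrA mulrAC ler_pdivlMr ?exprn_gt0 //.
rewrite -!natrX -!natrM ler_nat.
rewrite big_distrl /=; under eq_bigr do rewrite big_distrl /=.
by apply: leq_trans cv _; rewrite mulnC.
Qed.

Variable g : col -> R.

Definition is_state z := proper_coloring z || singly_flawed z.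

Definition move_energy w z : R :=
  \sum_(c | is_state (recolor z w c)) (g z - g (recolor z w c)) ^+ 2.

Definition vertex_energy w : R := \sum_(z | is_state z) move_energy w z.

Definition total_energy : R := \sum_w vertex_energy w.

(** The expected squared change of [g] from the start of the path to its state after [pr], summed
    over all pairs of endpoints. *)
Definition displacement pr : R :=
  \sum_(s in proper_set) \sum_(t in proper_set)
    (\sum_(z <- outcomes s t pr) (g s - g z) ^+ 2) / q%:R ^+ size pr.

Lemma vertex_energy_ge0 w : 0 <= vertex_energy w.
Proof. by apply: sumr_ge0 => z _; apply: sumr_ge0 => c _; exact: sqr_ge0. Qed.

Lemma inv_is_state pr A D u U s t z : path_inv pr A D u U ->
  s \in proper_set -> t \in proper_set -> z \in outcomes s t pr -> is_state z.
Proof.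
rewrite !inE => inv ps pt zo; have [_ _ zm] := inv_val inv ps pt zo.
by apply: (sf_stateP (u := u)) => x y /zm[[-> _]|[-> _]]; rewrite eqxx ?orbT.
Qed.

Lemma sum_seq_count (l : seq col) (f : col -> R) :
  \sum_(z <- l) f z = \sum_z (count_mem z l)%:R * f z.
Proof.
under [RHS]eq_bigr do rewrite -sum1_count natr_sum mulr_suml big_mkcond /=.
rewrite exchange_big /=; apply: eq_bigr => z _.
by rewrite -big_mkcond (big_pred1 z) ?mul1r // => y; rewrite eq_sym.
Qed.

(** Every step is a move between states at the vertex [i.2], so its squared increment is one of the
    terms of [move_energy]. Bounding each of the [q] outcomes by the whole of [move_energy] cancels
    one factor [q]; the weights of the starting states [z] are then summed by [count_visits_le]. *)
Lemma step_energy pr i A D u U A' D' u' U' : path_inv pr A D u U -> (#|D| <= p)%N ->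
  path_inv (rcons pr i) A' D' u' U' ->
  \sum_(s in proper_set) \sum_(t in proper_set)
    (\sum_(z <- outcomes s t pr) \sum_(c : 'I_q) (g z - g (path_step t i z c)) ^+ 2)
       / q%:R ^+ (size pr).+1 <= visit_bound * vertex_energy i.2.
Proof.
move=> inv Dp inv'; have q0 : 0 < q%:R :> R by rewrite ltr0n.
have h s t : s \in proper_set -> t \in proper_set ->
  (\sum_(z <- outcomes s t pr) \sum_(c : 'I_q) (g z - g (path_step t i z c)) ^+ 2)
       / q%:R ^+ (size pr).+1 <=
  \sum_(z | is_state z) (count_mem z (outcomes s t pr))%:R / q%:R ^+ size pr * move_energy i.2 z.
  move=> ps pt.
  rewrite exprSr invfM.
  apply: (@le_trans _ _ ((q%:R * \sum_(z <- outcomes s t pr) move_energy i.2 z) *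
      ((q%:R ^+ size pr)^-1 / q%:R))).
    rewrite ler_wpM2r ?mulr_ge0 ?invr_ge0 ?exprn_ge0 ?ler0n // mulr_sumr !big_seq.
    apply: ler_sum => z zo.
    rewrite -[q in q%:R]card_ord mulr_natl -sumr_const; apply: ler_sum => c _.
    have ok' : is_state (path_step t i z c).
      apply: (inv_is_state inv' ps pt); rewrite outcomes_rcons.
      by apply/allpairsP; exists (z, c); split=> //; rewrite mem_enum.
    rewrite /move_energy /path_step (bigD1 (if i.1 then t i.2 else pick_color z i.2 c)) //=.
    by rewrite lerDl sumr_ge0 // => d _; exact: sqr_ge0.
  rewrite mulrC -mulrA mulKf ?gt_eqF // mulrC.
  rewrite sum_seq_count mulr_suml [leRHS]big_mkcond; apply: ler_sum => z _ /=.
  case: ifP => zs; first by rewrite mulrAC.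
  have /count_memPn -> : z \notin outcomes s t pr.
    by apply/negP => /(inv_is_state inv ps pt); rewrite zs.
  by rewrite !mul0r.
apply: (@le_trans _ _ (\sum_(s in proper_set) \sum_(t in proper_set)
  \sum_(z | is_state z) (count_mem z (outcomes s t pr))%:R / q%:R ^+ size pr * move_energy i.2 z)).
  by apply: ler_sum => s ps; apply: ler_sum => t pt; exact: h.
under eq_bigr do rewrite exchange_big /=.
rewrite exchange_big /= mulr_sumr; apply: ler_sum => z _.
under eq_bigr do rewrite -mulr_suml.
rewrite -mulr_suml ler_wpM2r //; last exact: count_visits_le inv Dp.
by apply: sumr_ge0 => c _; exact: sqr_ge0.
Qed.

(** An incremental form of Cauchy-Schwarz, with weights chosen for appending one step to a path of
    length [m]. *)
Lemma sqr_sub_split (m x a b : R) :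
  m * (x - b) ^+ 2 <= (m + 1) * (x - a) ^+ 2 + m * (m + 1) * (a - b) ^+ 2.
Proof. by rewrite -subr_ge0 (_ : _ - _ = ((x - a) - m * (a - b)) ^+ 2) ?sqr_ge0 //; ring. Qed.

(** Dividing [sqr_sub_split] by [m = size pr] turns the bound [m * M * S] into
    [(m + 1) * (M * S + L)], where [L] is the energy of the new step. The bound thus keeps the form
    of length times accumulated energy. *)
Lemma displacement_rcons pr i A D u U A' D' u' U' (S : R) :
  path_inv pr A D u U -> (#|D| <= p)%N -> path_inv (rcons pr i) A' D' u' U' ->
  0 <= S -> displacement pr <= (size pr)%:R * (visit_bound * S) ->
  displacement (rcons pr i) <=
    (size (rcons pr i))%:R * (visit_bound * (S + vertex_energy i.2)).
Proof.
move=> inv Dp inv' S0 IH; have q0 : 0 < q%:R :> R by rewrite ltr0n.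
have := step_energy inv Dp inv'; set L := (X in X <= _) => hL.
have M0 := visit_bound_ge0.
have dE : displacement (rcons pr i) = \sum_(s in proper_set) \sum_(t in proper_set)
    (\sum_(z <- outcomes s t pr) \sum_(c : 'I_q) (g s - g (path_step t i z c)) ^+ 2)
       / q%:R ^+ (size pr).+1.
  apply: eq_bigr => s _; apply: eq_bigr => t _; rewrite size_rcons; congr (_ / _).
  by rewrite outcomes_rcons big_allpairs_dep; apply: eq_bigr => z _; rewrite big_enum.
rewrite size_rcons.
have MS0 : 0 <= visit_bound * S by rewrite mulr_ge0.
(* For an empty [pr] there is no [m] to divide by, but the displacement is then the energy of the
   single step. *)
case: pr inv inv' @L hL dE IH => [|j pr] inv inv' L hL dE IH.
  rewrite dE mul1r mulrDr; apply: le_trans (le_trans hL _); last by rewrite lerDr.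
  by apply: ler_sum => s _; apply: ler_sum => t _; rewrite /outcomes /= !big_seq1.
have t0 : 0 < (size (j :: pr))%:R :> R by rewrite ltr0n.
rewrite -(ler_pM2l t0) -[(size _).+1]addn1 natrD.
set m : R := (size (j :: pr))%:R in t0 IH *.
have h : m * displacement (rcons (j :: pr) i) <=
   (m + 1) * displacement (j :: pr) + m * (m + 1) * L.
  rewrite dE /displacement /L !mulr_sumr -big_split; apply: ler_sum => s _ /=.
  rewrite !mulr_sumr -big_split; apply: ler_sum => t _ /=.
  rewrite exprSr invfM.
  set qn := (q%:R ^+ _)^-1.
  have qn0 : 0 <= qn by rewrite invr_ge0 exprn_ge0 // ltW.
  rewrite (_ : (m + 1) * _ = (m + 1) *
    ((\sum_(z <- outcomes s t (j :: pr)) \sum_(c : 'I_q) (g s - g z) ^+ 2) * (qn / q%:R))); last first.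
    congr (_ * _); rewrite [qn / _]mulrC mulrA; congr (_ * _); rewrite mulr_suml; apply: eq_bigr => z _.
    by rewrite sumr_const card_ord -[_ ^+ 2 *+ q]mulr_natr mulfK // gt_eqF.
  rewrite !mulrA -!mulrDl.
  apply: ler_wpM2r; first by rewrite invr_ge0 ltW.
  apply: ler_wpM2r => //.
  rewrite !mulr_sumr -big_split; apply: ler_sum => z _ /=.
  rewrite !mulr_sumr -big_split; apply: ler_sum => c _ /=.
  exact: sqr_sub_split.
apply: le_trans h _.
have : (m + 1) * displacement (j :: pr) <= (m + 1) * (m * (visit_bound * S)).
  by rewrite ler_wpM2l // addr_ge0 // ltW.
have : m * (m + 1) * L <= m * (m + 1) * (visit_bound * vertex_energy i.2).
  by rewrite ler_wpM2l // mulr_ge0 // ?addr_ge0 // ltW.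
by move: (visit_bound) => M; lra.
Qed.

(** The set [V] records the vertices updated since the stage began. Being disjoint from [U], it
    shows that a stage updates no vertex twice: a stage has at most [#|G|] steps and uses at most
    one copy of [total_energy]. *)
Lemma stage_neighbors m pr A D u U V : path_inv pr A D u U ->
  (#|bd A| <= p)%N -> U \subset ~: V -> (size pr <= m * #|G| + #|V|)%N ->
  displacement pr <= (size pr)%:R *
    (visit_bound * (m%:R * total_energy + \sum_(w in V) vertex_energy w)) ->
  exists pr' D', [/\ path_inv pr' A D' u finset.set0, (size pr' <= m.+1 * #|G|)%N
    & displacement pr' <= (size pr')%:R * (visit_bound * (m.+1%:R * total_energy))].
Proof.
move=> inv Ap; have [n leUn] := ubnP #|U|.
elim: n U leUn pr D V inv => // n IH U /ltnSE leUn pr D V inv UV szV dV.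
have V_le : \sum_(w in V) vertex_energy w <= total_energy.
  rewrite /total_energy big_mkcond; apply: ler_sum => w _.
  by case: ifP => _ //; exact: vertex_energy_ge0.
have [U0|[w wU]] := set_0Vmem U.
  exists pr, D; split; first by rewrite -U0.
    by rewrite mulSnr (leq_trans szV) // leq_add2l max_card.
  apply: le_trans dV _; rewrite ler_wpM2l ?ler0n // ler_wpM2l ?visit_bound_ge0 //.
  by rewrite mulrSr mulrDl mul1r lerD2l.
have wV : w \notin V by have := fintype.subsetP UV w wU; rewrite finset.in_setC.
have Dp : (#|D| <= p)%N.
  apply: leq_trans Ap; apply: subset_leq_card; apply/fintype.subsetP => y yD.
  by apply: (inv_sub inv); rewrite yD.
have inv' := path_inv_rand inv wU.
apply: (IH _ _ _ _ (w |: V) inv').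
- by apply: leq_trans leUn; rewrite [X in (_ < X)%N](cardsD1 w) wU.
- apply/fintype.subsetP => x; rewrite !inE negb_or => /andP[-> /(fintype.subsetP UV)].
  by rewrite inE.
- by rewrite size_rcons cardsU1 wV addnCA add1n ltnS.
- rewrite big_setU1 //= [vertex_energy w + _]addrC addrA.
  apply: (displacement_rcons inv Dp inv') => //.
  rewrite addr_ge0 ?mulr_ge0 ?ler0n // ?sumr_ge0 // => x _; exact: vertex_energy_ge0.
Qed.

Lemma total_energy_ge0 : 0 <= total_energy.
Proof. by apply: sumr_ge0 => w _; exact: vertex_energy_ge0. Qed.

Lemma stages o1 o2 pr D u :
  path_inv pr [set x in o1] D u finset.set0 -> uniq (o1 ++ o2) ->
  (forall i, (#|bd [set x in take i (o1 ++ o2)]| <= p)%N) ->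
  (size pr <= size o1 * #|G|)%N ->
  displacement pr <= (size pr)%:R * (visit_bound * ((size o1)%:R * total_energy)) ->
  exists pr' D' u', [/\ path_inv pr' [set x in o1 ++ o2] D' u' finset.set0,
     (size pr' <= size (o1 ++ o2) * #|G|)%N
    & displacement pr' <=
      (size pr')%:R * (visit_bound * ((size (o1 ++ o2))%:R * total_energy))].
Proof.
elim: o2 o1 pr D u => [|v o2 IH] o1 pr D u inv.
  by rewrite cats0 => _ _ sz d; exists pr, D, u.
rewrite -cat_rcons => uo op sz d.
have vo1 : v \notin [set x in o1].
  by move: uo; rewrite cat_uniq rcons_uniq inE => /and3P[/andP[]].
have inv' := path_inv_fix inv vo1.
have o1v : v |: [set x in o1] = [set x in rcons o1 v].
  by apply/setP => x; rewrite !inE mem_rcons in_cons.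
have Dp : (#|D| <= p)%N.
  apply: leq_trans (op (size o1)); rewrite cat_rcons take_size_cat //.
  apply: subset_leq_card; apply/fintype.subsetP => y yD.
  by apply: (inv_sub inv); rewrite yD.
have o1vp : (#|bd (v |: [set x in o1])| <= p)%N.
  by have := op (size (rcons o1 v)); rewrite take_size_cat // o1v.
have [|||pr' [D' [inv'' sz' d']]] := stage_neighbors (m := size o1) (V := [set v]) inv' o1vp.
- apply/fintype.subsetP => x; rewrite !inE => /andP[vx _].
  by apply: contraTneq vx => ->; rewrite edge_irr.
- by rewrite size_rcons cards1 addn1 ltnS.
- rewrite big_set1; apply: (displacement_rcons inv Dp inv') => //.
  by rewrite mulr_ge0 ?ler0n ?total_energy_ge0.
apply: (IH (rcons o1 v) pr' D' v) => //; rewrite ?size_rcons -?o1v //.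
Qed.

(** The factor [n ^ 3] is the path length, at most [n ^ 2], times the [n] stages that each use one
    copy of [total_energy]. *)
Lemma proper_energy (o : seq G) : uniq o -> (forall v, v \in o) ->
  (forall i, (#|bd [set x in take i o]| <= p)%N) ->
  \sum_(s in proper_set) \sum_(t in proper_set) (g s - g t) ^+ 2 <=
  #|G|%:R ^+ 3 * (visit_bound * total_energy).
Proof.
move=> uo oG op; have q0 : 0 < q%:R :> R by rewrite ltr0n.
have Gsz : size o = #|G|.
  by have /card_uniqP <- := uo; apply: eq_card => v; rewrite oG inE.
have V0 := visit_bound_ge0; have E0 := total_energy_ge0.
case: o uo oG op Gsz => [|v o] uo oG op Gsz.
  rewrite big1 ?mulr_ge0 ?exprn_ge0 ?ler0n // => s _; rewrite big1 // => t _.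
  suff -> : s = t by rewrite subrr expr0n.
  by apply/ffunP => x; have := oG x.
(* With [U] empty the flaw vertex is only a placeholder, so the first vertex [v] serves. *)
have inv0 : path_inv [::] [set x in ([::] : seq G)] finset.set0 v finset.set0.
  rewrite (_ : [set x in _] = finset.set0); first exact: path_inv_nil.
  by apply/setP => x; rewrite !inE.
have [||pr [D [u [inv sz d]]]] := stages (o2 := v :: o) inv0 uo op.
- by [].
- rewrite mul0r /displacement big1 // => s _; rewrite big1 // => t _.
  by rewrite /outcomes /= big_seq1 subrr expr0n mul0r.
(* Once all vertices are processed, every outcome equals [t]. *)
have -> : \sum_(s in proper_set) \sum_(t in proper_set) (g s - g t) ^+ 2 = displacement pr.
  apply: eq_bigr => s; rewrite inE => ps; apply: eq_bigr => t; rewrite inE => pt.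
  apply: (canRL (mulfK _)); first by rewrite expf_neq0 // gt_eqF.
  transitivity (\sum_(z <- outcomes s t pr) (g s - g t) ^+ 2).
    by rewrite big_const_seq count_predT size_outcomes iter_addr addr0 -natrX mulr_natr.
  rewrite big_seq [RHS]big_seq; apply: eq_bigr => z zo.
  have [zA _ _] := inv_val inv ps pt zo.
  by congr ((_ - g _) ^+ 2); apply/ffunP => x; rewrite zA // inE /= oG.
move: sz d; rewrite [[::] ++ _]/= Gsz => sz d; apply: le_trans d _.
apply: (@le_trans _ _ ((#|G| * #|G|)%:R * (visit_bound * (#|G|%:R * total_energy)))).
  by rewrite ler_wpM2r ?ler_nat // !mulr_ge0 // ler0n.
have -> // : (#|G| * #|G|)%:R * (visit_bound * (#|G|%:R * total_energy)) =
  #|G|%:R ^+ 3 * (visit_bound * total_energy).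
by rewrite natrM; ring.
Qed.

End RandomPath.

(** * Poincare inequality for the Single-Flaw dynamics *)

Lemma sqr_sub_double (R : realType) (a b c : R) :
  (a - c) ^+ 2 <= 2 * (a - b) ^+ 2 + 2 * (b - c) ^+ 2.
Proof. by rewrite -subr_ge0 (_ : _ - _ = (a - b - (b - c)) ^+ 2) ?sqr_ge0 //; ring. Qed.

Lemma sum_sqr_sub_ge (R : realType) (S : finType) (f : S -> R) (c : R) :
  \sum_x f x = 0 -> \sum_x f x ^+ 2 <= \sum_x (f x - c) ^+ 2.
Proof.
move=> f0.
have -> : \sum_x (f x - c) ^+ 2 = \sum_x f x ^+ 2 - 2 * c * \sum_x f x + \sum_(x : S) c ^+ 2.
  by rewrite mulr_sumr -sumrB -[RHS]big_split; apply: eq_bigr => x _ /=; ring.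
by rewrite f0 mulr0 subr0 lerDl sumr_ge0 // => x _; exact: sqr_ge0.
Qed.

Lemma sum_sqr_sub_mean (R : realType) (I : finType) (A : {set I}) (g : I -> R) :
  (0 < #|A|)%N ->
  2 * #|A|%:R * \sum_(s in A) (g s - (\sum_(t in A) g t) / #|A|%:R) ^+ 2 =
  \sum_(s in A) \sum_(t in A) (g s - g t) ^+ 2.
Proof.
move=> A0; have a0 : #|A|%:R != 0 :> R by rewrite pnatr_eq0 -lt0n.
set N : R := #|A|%:R in a0 *; pose S1 := \sum_(t in A) g t.
pose S2 := \sum_(t in A) g t ^+ 2.
have sqE (m : R) : \sum_(s in A) (g s - m) ^+ 2 = S2 - 2 * m * S1 + N * m ^+ 2.
  rewrite [N * _]mulr_natl -[_ *+ #|A|]sumr_const /S1 mulr_sumr -sumrB -[RHS]big_split.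
  by apply: eq_bigr => s _ /=; ring.
transitivity (\sum_(s in A) (N * g s ^+ 2 - 2 * S1 * g s + S2)).
  rewrite -/S1 sqE big_split sumrB /= -!mulr_sumr sumr_const -[_ *+ _]mulr_natr.
  by rewrite -/S1 -/S2 -/N; field.
apply: eq_bigr => s _.
transitivity (\sum_(t in A) (g t - g s) ^+ 2); first by rewrite sqE; ring.
by apply: eq_bigr => t _; ring.
Qed.

Section SingleFlawChain.
Variables (R : realType) (G : sgraph) (k q : nat).
Local Notation col := {ffun G -> 'I_k}.
Local Notation state := (sf_state G k).
Local Notation n := #|G|.
Hypothesis q_gt0 : (0 < q)%N.
Hypothesis q_deg : (max_degree G + q <= k)%N.
Hypothesis n_gt0 : (0 < n)%N.

Lemma k_gt0 : (0 < k)%N.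
Proof. exact: leq_trans q_gt0 (leq_trans (leq_addl _ _) q_deg). Qed.

Lemma avail_ge (z : col) w : (q <= #|avail z w|)%N.
Proof.
have : (#|~: avail z w| <= max_degree G)%N.
  apply: (@leq_trans #|[set u | edge w u]|); last first.
    exact: (@bigop.leq_bigmax _ (fun v : G => #|[set u | edge v u]|) w).
  apply: leq_trans (leq_imset_card (fun u => z u) _).
  apply: subset_leq_card; apply/fintype.subsetP => c.
  rewrite !inE negb_forall => /existsP[u]; rewrite negb_imply negbK => /andP[wu /eqP <-].
  by apply: imset_f; rewrite inE.
have := cardsC (avail z w); rewrite card_ord; move: q_deg; lia.
Qed.

Lemma recolor_id (z : col) v : recolor z v (z v) = z.
Proof. by apply/ffunP => x; rewrite recolorE; case: eqP => [->|]. Qed.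

Lemma recolor_recolor (z : col) v c d : recolor (recolor z v c) v d = recolor z v d.
Proof. by apply/ffunP => x; rewrite !recolorE; case: eqP. Qed.

(** All monochromatic edges of a flawed state share the vertex [w], and an available color at [w]
    removes them. A proper coloring is recolored with a color it already has. *)
Lemma recolor_to_proper (z : col) : is_state z -> exists v c, proper_coloring (recolor z v c).
Proof.
have /card_gt0P[v0 _] := n_gt0.
case/orP => [pz|/andP[_ /existsP[w /forallP wP]]].
  by exists v0, (z v0); rewrite recolor_id.
have /card_gt0P[c] : (0 < #|avail z w|)%N by apply: leq_trans (avail_ge z w).
rewrite inE => /forallP cw; exists w, c; apply/proper_coloringP => x y.
rewrite /monochromatic !recolorE.
case: (eqVneq x w) => [->|xw]; case: (eqVneq y w) => [->|yw] /=.
- by rewrite edge_irr.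
- by have := cw y; case: edge => //=; rewrite eq_sym.
- by have := cw x; rewrite edge_sym; case: edge.
- apply/negP => xy; have /forallP/(_ y)/implyP/(_ xy) := wP x.
  by rewrite eq_sym (negbTE xw) eq_sym (negbTE yw).
Qed.

(** The map sending [(z, c)] to [(recolor z v c, z v)] is an involution, since the pair remembers
    the overwritten color. *)
Lemma sum_recolor (F : col -> R) v :
  \sum_z \sum_c F (recolor z v c) = k%:R * \sum_z F z.
Proof.
pose phi (zc : col * 'I_k) := (recolor zc.1 v zc.2, zc.1 v).
have phiK : involutive phi.
  by move=> [z c]; rewrite /phi /= recolor_recolor recolor_id recolor_eq.
transitivity (\sum_z \sum_(c : 'I_k) F z).
  rewrite !pair_bigA /= [RHS](reindex_inj (inv_inj phiK)) /=.
  by apply: eq_bigr => -[].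
by rewrite mulr_sumr; apply: eq_bigr => z _; rewrite sumr_const card_ord mulr_natl.
Qed.

Lemma card_proper_gt0 : (0 < #|proper_set G k|)%N.
Proof.
pose s : col := [ffun=> Ordinal k_gt0].
have : (q ^ #|[set: G]| <= #|[set z in agree (~: [set: G]) s | proper_coloring z]|)%N.
  by apply: (card_extensions avail_ge) => x y; rewrite inE.
move=> h; apply: leq_trans (leq_trans h _); first by rewrite expn_gt0 q_gt0.
by apply: subset_leq_card; apply/fintype.subsetP => z; rewrite !inE => /andP[_ ->].
Qed.

Lemma card_state_gt0 : (0 < #|{: state}|)%N.
Proof.
have [z pz] : exists z, z \in proper_set G k by exact/card_gt0P/card_proper_gt0.
have zs : is_state z by rewrite /is_state; move: pz; rewrite inE => ->.
by apply/card_gt0P; exists (Sub z zs).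
Qed.

(** The path estimates concern functions on all colorings; the value 0 off the states is harmless
    because [total_energy] only involves states. *)
Definition extend_by_0 (f : state -> R) (z : col) : R :=
  if insub z is Some x then f x else 0.

Lemma extend_by_0_val f x : extend_by_0 f (val x) = f x.
Proof. by rewrite /extend_by_0 valK. Qed.

Lemma val_sf_move (x : state) v c :
  val (sf_move x v c) = if is_state (recolor (val x) v c) then recolor (val x) v c else val x.
Proof. by rewrite /sf_move val_insubd. Qed.

Lemma sum_state (F : col -> R) : \sum_(x : state) F (val x) = \sum_(z | is_state z) F z.
Proof.
rewrite (reindex_omap (val : state -> col) insub) /=; last first.
  by move=> z zs; rewrite insubT.
by apply: eq_bigl => x; rewrite valK eqxx andbT; apply/esym; exact: (valP x).
Qed.

(** * The proposal kernel, which is the non-lazy half of the chain, and its Dirichlet form *)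

Definition proposal (x y : state) : R :=
  \sum_(v : G) \sum_(c < k) (n%:R * k%:R)^-1 * (sf_move x v c == y)%:R.

Lemma nk_gt0 : 0 < n%:R * k%:R :> R.
Proof. by rewrite mulr_gt0 ?ltr0n ?k_gt0. Qed.

Lemma proposal_ge0 x y : 0 <= proposal x y.
Proof.
apply: sumr_ge0 => v _; apply: sumr_ge0 => c _.
by rewrite mulr_ge0 ?ler0n // invr_ge0 ltW // nk_gt0.
Qed.

Lemma sum_proposal (x : state) (F : state -> R) :
  \sum_y proposal x y * F y =
  (n%:R * k%:R)^-1 * \sum_v \sum_c F (sf_move x v c).
Proof.
rewrite /proposal; under eq_bigr do rewrite mulr_suml.
rewrite exchange_big mulr_sumr; apply: eq_bigr => v _ /=.
under eq_bigr do rewrite mulr_suml.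
rewrite exchange_big mulr_sumr; apply: eq_bigr => c _ /=.
rewrite -[F _ in RHS](sum_delta F (sf_move x v c)) mulr_sumr.
by apply: eq_bigr => y _; rewrite mulrA.
Qed.

Lemma proposal_row x : \sum_y proposal x y = 1.
Proof.
under eq_bigr do rewrite -[proposal _ _]mulr1.
rewrite (sum_proposal x (fun=> 1)); under eq_bigr do rewrite sumr_const card_ord.
by rewrite sumr_const -mulrnA mulnC natrM mulVf // gt_eqF // nk_gt0.
Qed.

(** For distinct states, only the color [val y v] at [v] can lead from [x] to [y], and the move is
    undone by restoring the old color at [v]. *)
Lemma proposal_sym x y : proposal x y = proposal y x.
Proof.
have [-> //|xy] := eqVneq x y.
apply: eq_bigr => v _; rewrite -!mulr_sumr; congr (_ * _).
have h (a b : state) : a != b ->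
    \sum_(c < k) (sf_move a v c == b)%:R = (recolor (val a) v (val b v) == val b)%:R :> R.
  move=> ab; rewrite (bigD1 (val b v)) //= big1 ?addr0 => [|c cb].
    congr (_%:R); rewrite -val_eqE val_sf_move; case: ifP => // ns.
    rewrite val_eqE (negbTE ab); case: eqP => // e.
    by move: ns; rewrite e => /negbT/negP; case; exact: (valP b).
  case: eqP => // e; move/eqP: cb; case; rewrite -e val_sf_move.
  case: ifP => ns; first by rewrite recolor_eq.
  by move/eqP: ab; case; rewrite -e; apply: val_inj; rewrite val_sf_move ns.
have yx : y != x by rewrite eq_sym.
rewrite !h //; congr ((nat_of_bool _)%:R).
have sw (a b : col) : recolor a v (b v) == b -> recolor b v (a v) == a.
  by move/eqP => e; rewrite -[X in recolor X]e recolor_recolor recolor_id.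
by apply/idP/idP; apply: sw.
Qed.

(** One factor 1/2 comes from the Dirichlet form and another from laziness. Rejected proposals stay
    put and contribute zero on both sides. *)
Lemma dirichlet_energy (f : state -> R) :
  2^-1 * \sum_x \sum_y sf_trans R x y * (f x - f y) ^+ 2 =
  (4 * (n%:R * k%:R))^-1 * total_energy (extend_by_0 f).
Proof.
have -> : total_energy (extend_by_0 f) =
    \sum_x \sum_v \sum_c (f x - f (sf_move x v c)) ^+ 2.
  rewrite exchange_big; apply: eq_bigr => v _.
  rewrite /vertex_energy -sum_state; apply: eq_bigr => x _.
  rewrite /move_energy big_mkcond; apply: eq_bigr => c _ /=.
  rewrite extend_by_0_val -(extend_by_0_val f (sf_move x v c)) val_sf_move.
  by case: ifP => // _; rewrite extend_by_0_val subrr expr0n.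
rewrite invfM !mulr_sumr; apply: eq_bigr => x _.
transitivity (2^-1 * (2^-1 * \sum_y proposal x y * (f x - f y) ^+ 2)).
  congr (_ * _); rewrite mulr_sumr; apply: eq_bigr => y _.
  rewrite /sf_trans -/(proposal x y); case: (eqVneq x y) => [->|xy] /=.
    by rewrite subrr expr0n !mulr0.
  by rewrite mulr0 add0r -mulrA.
by rewrite sum_proposal; field; rewrite gt_eqF ?ltr0n ?k_gt0 // gt_eqF ?ltr0n.
Qed.

(** * The variance bound and the spectral gap *)

Variables (p : nat) (o : seq G).
Hypothesis uo : uniq o.
Hypothesis oG : forall v, v \in o.
Hypothesis op : forall i, (#|bd [set x in take i o]| <= p)%N.

Local Notation H := (k%:R / q%:R : R).

(** The function is centered at its mean [m] over the proper colorings instead of over all states,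
    which can only increase the sum. A state is then compared with a proper coloring one move away:
    the moves cost [2 * total_energy], and each proper coloring is counted at most [n k] times. The
    variance on the proper colorings is bounded by [proper_energy]. *)
Lemma variance_energy (f : state -> R) : \sum_x f x = 0 ->
  \sum_x f x ^+ 2 <=
  (2 + n%:R ^+ 4 * k%:R * H ^+ (2 * p + 1)) * total_energy (extend_by_0 f).
Proof.
move=> f0; set g := extend_by_0 f; set C := proper_set G k.
pose m := (\sum_(t in C) g t) / #|C|%:R.
apply: le_trans (sum_sqr_sub_ge m f0) _.
have -> : \sum_x (f x - m) ^+ 2 = \sum_(z | is_state z) (g z - m) ^+ 2.
  by rewrite -sum_state; apply: eq_bigr => x _; rewrite /g extend_by_0_val.
pose h z : R := if z \in C then (g z - m) ^+ 2 else 0.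
have h0 z : 0 <= h z by rewrite /h; case: ifP => // _; exact: sqr_ge0.
(* Summing over all [v] and [c] avoids choosing the neighboring proper coloring; [h] vanishes on
   improper ones. *)
have step z : is_state z -> (g z - m) ^+ 2 <=
    2 * \sum_v move_energy g v z + 2 * \sum_v \sum_c h (recolor z v c).
  move=> zs; have [v [c pc]] := recolor_to_proper zs.
  apply: (@le_trans _ _ (2 * (g z - g (recolor z v c)) ^+ 2 + 2 * h (recolor z v c))).
    by rewrite /h inE pc; exact: sqr_sub_double.
  apply: lerD; rewrite ler_wpM2l //.
    rewrite (bigD1 v) //= /move_energy (bigD1 c) /=; last by rewrite /is_state pc.
    rewrite -addrA lerDl addr_ge0 ?sumr_ge0 // => [d _|w _]; first exact: sqr_ge0.
    by apply: sumr_ge0 => d _; exact: sqr_ge0.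
  rewrite (bigD1 v) //= (bigD1 c) //= -addrA lerDl addr_ge0 ?sumr_ge0 // => w _.
  by apply: sumr_ge0 => d _.
apply: le_trans (ler_sum _ step) _.
rewrite big_split -!mulr_sumr /= exchange_big /= -/(total_energy g) [leRHS]mulrDl lerD //.
have hC : \sum_z h z = \sum_(s in C) (g s - m) ^+ 2 by rewrite [RHS]big_mkcond.
apply: (@le_trans _ _ (2 * (n%:R * (k%:R * \sum_z h z)))).
  rewrite ler_wpM2l //.
  apply: (@le_trans _ _ (\sum_z \sum_v \sum_c h (recolor z v c))).
    rewrite big_mkcond; apply: ler_sum => z _; case: ifP => // _.
    by apply: sumr_ge0 => v _; apply: sumr_ge0 => c _.
  rewrite exchange_big /=; under eq_bigr do rewrite sum_recolor.
  by rewrite sumr_const -[leLHS]mulr_natl.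
have C0 : 0 < #|C|%:R :> R by rewrite ltr0n card_proper_gt0.
have qk : (q <= k)%N by move: q_deg; lia.
have := proper_energy q_gt0 avail_ge qk g uo oG op.
rewrite -/C -(sum_sqr_sub_mean g card_proper_gt0) -/C -/m -hC.
set X := \sum_z h z; set E := total_energy g; set HH := H ^+ _.
move=> le1; have {}le1 : 2 * X <= n%:R ^+ 3 * (HH * E).
  rewrite -(ler_pM2l C0); apply: le_trans (le_trans le1 _).
    by rewrite le_eqVlt; apply/orP; left; apply/eqP; ring.
  by rewrite le_eqVlt; apply/orP; left; apply/eqP; ring.
have -> : n%:R ^+ 4 * k%:R * HH * E = n%:R * k%:R * (n%:R ^+ 3 * (HH * E)) by ring.
have -> : 2 * (n%:R * (k%:R * X)) = n%:R * k%:R * (2 * X) by ring.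
by rewrite ler_wpM2l // ltW // nk_gt0.
Qed.

Definition sf_gap : R :=
  (4 * (n%:R * k%:R) * (2 + n%:R ^+ 4 * k%:R * H ^+ (2 * p + 1)))^-1.

Lemma sf_gap01 : 0 < sf_gap <= 1.
Proof.
have n1 : 1 <= n%:R :> R by rewrite ler1n.
have k1 : 1 <= k%:R :> R by rewrite ler1n k_gt0.
have nk1 : 1 <= n%:R * k%:R :> R by rewrite mulr_ege1.
have A0 : 0 <= n%:R ^+ 4 * k%:R * H ^+ (2 * p + 1).
  by rewrite !mulr_ge0 ?exprn_ge0 ?mulr_ge0 ?invr_ge0 ?ler0n.
have D1 : 1 <= 4 * (n%:R * k%:R) * (2 + n%:R ^+ 4 * k%:R * H ^+ (2 * p + 1)).
  rewrite mulr_ege1 //; lra.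
by rewrite invr_gt0 (lt_le_trans ltr01 D1) invf_le1 ?(lt_le_trans ltr01 D1).
Qed.

Lemma sf_mixing_time_le (delta : R) (t0 : nat) : 0 < delta ->
  ln #|{: state}|%:R + 2 * ln delta^-1 <= sf_gap * t0%:R ->
  (mixing_time (@sf_trans G k R) (@uniform_dist R _) delta <= t0%:R%:E)%E.
Proof.
move=> d0 ht.
apply: (mixing_time_le proposal_ge0 proposal_sym proposal_row sf_gap01) => //; last exact: card_state_gt0.
move=> f f0; have := dirichlet_energy f; rewrite /sf_trans => ->.
rewrite /sf_gap invfM -[leLHS]mulrA.
rewrite ler_wpM2l ?invr_ge0 ?mulr_ge0 ?ler0n // ler_pdivrMl ?variance_energy //; lra.
Qed.

End SingleFlawChain.

(** * The mixing time bound *)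

Lemma card_sf_state (G : sgraph) (k : nat) : (#|{: sf_state G k}| <= k ^ #|G|)%N.
Proof.
have := leq_card (val : sf_state G k -> {ffun G -> 'I_k}) val_inj.
by rewrite card_ffun card_ord.
Qed.

Lemma ln_le (R : realType) (x : R) : 0 < x -> ln x <= x - 1.
Proof. by move=> x0; have := expR_ge1Dx (ln x); rewrite lnK ?posrE //; lra. Qed.

Lemma ln2_ge (R : realType) : 2^-1 <= ln (2 : R).
Proof.
have i2 : 0 < (2 : R)^-1 by rewrite invr_gt0.
by have := ln_le i2; rewrite lnV ?posrE //; lra.
Qed.

(* The integrality of (1 + eps) / eps forces eps <= 1; this is what keeps the *)
(* number of colors linear in the number of vertices.                         *)
Lemma admissible_facts (R : realType) (G : sgraph) (eps : R) : admissible G eps ->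
  [/\ 0 < eps <= 1, (1 + eps) * (max_degree G)%:R = (num_colors G eps)%:R,
      (max_degree G + 2 <= num_colors G eps)%N, (1 < #|G|)%N & (0 < pathwidth G)%N].
Proof.
move=> [e0 deg _ kint Hint].
have kE : (1 + eps) * (max_degree G)%:R = (num_colors G eps)%:R.
  apply/esym; rewrite /num_colors.
  have /natrP[m ->] : (1 + eps) * (max_degree G)%:R \is a Num.nat.
    by rewrite natrEint kint mulr_ge0 ?ler0n // addr_ge0 // ltW.
  by rewrite natrK.
have k2 : (max_degree G + 2 <= num_colors G eps)%N by rewrite -(ler_nat R) natrD -kE.
have e1 : eps <= 1.
  have HE : (1 + eps) * eps^-1 = 1 + eps^-1 by rewrite mulrDl mul1r divff ?gt_eqF // addrC.
  have : 2 <= (1 + eps) * eps^-1.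
    move: Hint => /intrP[m Hm]; rewrite Hm; rewrite HE in Hm.
    have : 1 < m%:~R :> R by rewrite -Hm ltrDl invr_gt0.
    by rewrite -[1]/(1%:~R) -[2]/(2%:~R) ltr_int ler_int; lia.
  rewrite HE => h; have : 1 <= eps^-1 by lra.
  by rewrite invf_ge1.
(* Without edges the maximal degree is 0 and the degree condition would read [2 <= 0]. *)
have [u [v uv]] : exists u v : G, edge u v.
  case: (boolP [exists u : G, exists v : G, edge u v]).
    by case/existsP=> u /existsP[v uv]; exists u, v.
  rewrite negb_exists => /forallP noe.
  have D0 : max_degree G = 0%N.
    apply/eqP; rewrite -leqn0; apply/bigmax_leqP => u _.
    rewrite leqn0 cards_eq0; apply/eqP/setP => v; rewrite !inE.
    by have := noe u; rewrite negb_exists => /forallP/(_ v)/negbTE.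
  by move: deg; rewrite D0 mulr0 add0r; lra.
split=> //; first by rewrite e0.
  apply/card_gt1P; exists u, v; split=> //.
  by apply: contraTneq uv => ->; rewrite edge_irr.
exact: pathwidth_gt0 uv.
Qed.

(** One factor [H] is traded for [k], which turns [k ^ 2 H ^ (2p + 1)] into [k ^ 3 H ^ (2p)]; the
    constant is [12 = 8 + 4]. *)
Lemma inv_gap_le (R : realType) (n k H : R) (p : nat) :
  1 <= n -> 1 <= k -> 1 <= H -> H <= k ->
  4 * (n * k) * (2 + n ^+ 4 * k * H ^+ (2 * p + 1)) <= 12 * (n ^+ 5 * k ^+ 3 * H ^+ (2 * p)).
Proof.
move=> n1 k1 H1 Hk; rewrite addn1 [H ^+ _.+1]exprSr; move: (H ^+ _) (exprn_ege1 (2 * p) H1) => h h1.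
have n4 : 1 <= n ^+ 4 by rewrite exprn_ege1.
have k2 : 1 <= k ^+ 2 by rewrite exprn_ege1.
have nk0 : 0 <= n * k by rewrite mulr_ge0 // (le_trans ler01).
have X1 : n * k <= n ^+ 5 * k ^+ 3 * h.
  have -> : n ^+ 5 * k ^+ 3 * h = n * k * (n ^+ 4 * (k ^+ 2 * h)) by ring.
  rewrite ler_peMr //; apply: mulr_ege1 => //.
  exact: mulr_ege1.
have X2 : n ^+ 5 * k ^+ 2 * h * H <= n ^+ 5 * k ^+ 2 * h * k.
  apply: ler_wpM2l => //; rewrite !mulr_ge0 ?exprn_ge0 //; lra.
have -> : 4 * (n * k) * (2 + n ^+ 4 * k * (h * H)) =
  8 * (n * k) + 4 * (n ^+ 5 * k ^+ 2 * h * H) by ring.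
have e : n ^+ 5 * k ^+ 3 * h = n ^+ 5 * k ^+ 2 * h * k by ring.
by move: X1 X2; rewrite e; move: (n * k) (n ^+ 5 * _ * _ * _) (n ^+ 5 * _ * _ * _) => a b c; lra.
Qed.

(** From [n >= 2] follows [k <= 2n <= n ^ 2], so each vertex contributes at most [2 ln n]. *)
Lemma ln_card_le (R : realType) (N n k : nat) :
  (0 < N <= k ^ n)%N -> (2 <= n)%N -> (0 < k)%N -> k%:R <= 2 * n%:R :> R ->
  ln N%:R <= 2 * (n%:R * ln n%:R) :> R.
Proof.
move=> /andP[N0 Nk] n2 k0 k2n.
have kn0 : (0 < k ^ n)%N by rewrite expn_gt0 k0.
have n2' : 2 <= n%:R :> R by rewrite ler_nat.
have n0' : 0 < n%:R :> R by rewrite (lt_le_trans _ n2').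
apply: (@le_trans _ _ (ln (k ^ n)%:R)).
  by rewrite ler_ln ?posrE ?ltr0n // ler_nat.
rewrite natrX lnXn ?ltr0n // -[_ *+ n]mulr_natl mulrCA ler_wpM2l ?ler0n //.
have -> : 2 * ln n%:R = ln (n%:R ^+ 2) :> R by rewrite lnXn // mulr_natl.
rewrite ler_ln ?posrE ?exprn_gt0 //; last by rewrite ltr0n.
by apply: le_trans k2n _; rewrite expr2 ler_wpM2r // ltW.
Qed.

Lemma mul_ln_ge1 (R : realType) (n : nat) : (2 <= n)%N -> 1 <= n%:R * ln n%:R :> R.
Proof.
move=> n2; have n2' : 2 <= n%:R :> R by rewrite ler_nat.
have : 2^-1 <= ln n%:R :> R.
  by apply: le_trans (ln2_ge R) _; rewrite ler_ln ?posrE // (lt_le_trans _ n2').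
nra.
Qed.

Lemma sf_mixing_bound_colors (R : realType) (G : sgraph) (k q : nat) (delta : R) :
  (0 < q)%N -> (max_degree G + q <= k)%N -> (1 < #|G|)%N -> k%:R <= 2 * #|G|%:R :> R ->
  0 < delta < 1 ->
  (mixing_time (@sf_trans G k R) (@uniform_dist R _) delta <=
     (25 * (#|G|%:R ^+ 5 * k%:R ^+ 3 * (k%:R / q%:R) ^+ (2 * pathwidth G)
        * (#|G|%:R * ln #|G|%:R + ln delta^-1)))%:E)%E.
Proof.
move=> q0 Dq n1 k2n /andP[d0 d1].
have [vs [uo oG op]] := elimination_order G.
have n0 : (0 < #|G|)%N by apply: ltnW.
have qk : (q <= k)%N by apply: leq_trans Dq; apply: leq_addl.
have k0 := leq_trans q0 qk.
have S0 := card_state_gt0 q0 Dq n0.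
have lnS : ln #|{: sf_state G k}|%:R <= 2 * (#|G|%:R * ln #|G|%:R) :> R.
  by apply: (ln_card_le (k := k)) => //; apply/andP; split; last exact: card_sf_state.
have nln := mul_ln_ge1 R n1.
have /andP[gap0 gap1] := sf_gap01 R q0 Dq n0 (pathwidth G).
have gapX : (sf_gap R G k q (pathwidth G))^-1 <=
    12 * (#|G|%:R ^+ 5 * k%:R ^+ 3 * (k%:R / q%:R) ^+ (2 * pathwidth G)).
  rewrite /sf_gap invrK; apply: inv_gap_le; rewrite ?ler1n ?H_ge1 //.
  by rewrite ler_pdivrMr ?ltr0n // ler_peMr ?ler0n // ler1n.
have X1 : 1 <= #|G|%:R ^+ 5 * k%:R ^+ 3 * (k%:R / q%:R) ^+ (2 * pathwidth G) :> R.
  by apply: mulr_ege1; [apply: mulr_ege1|]; rewrite exprn_ege1 ?ler1n ?H_ge1.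
have mt t0 := @sf_mixing_time_le R G k q q0 Dq n0 _ _ uo oG op delta t0 d0.
have L0 : 0 <= ln delta^-1 by rewrite ln_ge0 // invf_ge1 // ltW.
move: gap0 {gap1} gapX X1 mt lnS nln L0.
move: (sf_gap _ _ _ _ _) (_ * _ ^+ (2 * pathwidth G)) (ln #|{: sf_state G k}|%:R) => gap X l.
move: (#|G|%:R * _) (ln delta^-1) => Y L gap0 gapX X1 mt lY Y1 L0.
(* The constant 25 is [12 * 2] from the bound on [T], plus 1 for rounding up to an integer time,
   which is absorbed because [X * (Y + L) >= 1]. *)
pose T := gap^-1 * (2 * (Y + L)).
have YL0 : 0 <= 2 * (Y + L) by lra.
have T0 : 0 <= T by rewrite mulr_ge0 // invr_ge0 ltW.
apply: (le_trans (mt (Num.truncn T).+1 _)).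
  apply: (@le_trans _ _ (gap * T)); first by rewrite /T mulVKf ?gt_eqF //; lra.
  by rewrite ler_wpM2l ?(ltW gap0) // ltW // truncnS_gt.
rewrite lee_fin -natr1.
have hT : (Num.truncn T)%:R <= T by rewrite truncn_le.
have TX : T <= 12 * X * (2 * (Y + L)) by rewrite ler_wpM2r.
have : 1 <= X * (Y + L) by apply: mulr_ege1 => //; lra.
lra.
Qed.

Lemma sf_mixing_bound (R : realType) (eps : R) (G : sgraph) (delta : R) :
  admissible G eps -> 0 < delta < 1 ->
  (sf_mixing_time G eps delta <=
     (25 * (pathwidth G)%:R * (1 + eps) ^+ 3 * (max_degree G)%:R ^+ 3
        * #|G|%:R ^+ 5 * ((1 + eps) * eps^-1) ^+ (2 * pathwidth G)
        * (#|G|%:R * ln #|G|%:R + ln delta^-1))%:E)%E.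
Proof.
move=> adm d01; have [/andP[e0 e1] kE k2 n1 pw0] := admissible_facts adm.
rewrite /sf_mixing_time; move: (num_colors G eps) kE k2 => k kE k2.
(* The number [q] of guaranteed choices is [k - max_degree G], which equals [eps * max_degree G];
   hence [k / q = (1 + eps) / eps]. *)
have q0 : (0 < k - max_degree G)%N.
  by rewrite subn_gt0; apply: leq_trans k2; rewrite addn2 ltnS leqnSn.
have Dk : (max_degree G <= k)%N by rewrite ltnW // -subn_gt0.
have qE : (k - max_degree G)%:R = eps * (max_degree G)%:R.
  by rewrite natrB // -kE mulrDl mul1r addrC addKr.
have Dn : (max_degree G <= #|G|)%N by apply/bigmax_leqP => v _; exact: max_card.
have k2n : k%:R <= 2 * #|G|%:R :> R.
  rewrite -kE; apply: ler_pM; rewrite ?ler0n ?ler_nat //; lra.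
have D0 : (max_degree G)%:R != 0 :> R.
  by apply: contraTneq q0 => D0; rewrite -(ltr_nat R) qE D0 mulr0 ltxx.
have HE : k%:R / (k - max_degree G)%:R = (1 + eps) * eps^-1.
  by rewrite qE -kE; field; rewrite D0 gt_eqF.
have := sf_mixing_bound_colors q0 _ n1 k2n d01; rewrite subnKC // => /(_ (leqnn _)).
move/le_trans; apply; rewrite lee_fin HE -kE.
have Y0 : 0 <= #|G|%:R * ln #|G|%:R + ln delta^-1.
  case/andP: d01 => d0 d1; have := mul_ln_ge1 R n1.
  have : 0 <= ln delta^-1 by rewrite ln_ge0 // invf_ge1 // ltW.
  lra.
move: (_ ^+ (2 * pathwidth G)) (exprn_ge0 (2 * pathwidth G) (ltW (divr_gt0 (addr_gt0 ltr01 e0) e0))) => h h0.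
move: (_ + ln _) Y0 => Y Y0.
rewrite [leRHS](_ : _ = (pathwidth G)%:R *
  (25 * (#|G|%:R ^+ 5 * ((1 + eps) * (max_degree G)%:R) ^+ 3 * h * Y))); last by ring.
(* The factor [pathwidth G] is at least 1, so it can be multiplied in. *)
rewrite ler_peMl ?ler1n // !mulr_ge0 ?exprn_ge0 ?mulr_ge0 ?ler0n //; lra.
Qed.

Theorem theorem1p1 (R : realType) :
  (exists2 K : R, 0 < K &
     forall (eps : R) (G : sgraph), admissible G eps ->
     forall delta : R, 0 < delta < 1 ->
     (sf_mixing_time G eps delta <=
       (K * (pathwidth G)%:R * (1 + eps) ^+ 3 * (max_degree G)%:R ^+ 3
          * #|G|%:R ^+ 5 * ((1 + eps) * eps^-1) ^+ (2 * pathwidth G)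
          * (#|G|%:R * ln #|G|%:R + ln delta^-1))%:E)%E)
  /\
  (forall (eps : R) (family : sgraph -> Prop),
     (forall G, family G -> admissible G eps) ->
     (exists (C : R) (n0 : nat), forall G, family G -> (n0 <= #|G|)%N ->
        (pathwidth G)%:R <= C * ln #|G|%:R) ->
     exists p : {poly R}, forall G, family G ->
       (sf_mixing_time G eps (2 * expR 1)^-1 <= (p.[#|G|%:R])%:E)%E).
Proof.
split.
  exists 25 => // eps G adm delta d01; exact: sf_mixing_bound.
move=> eps family adm [C [n0 pwC]].
set H := (1 + eps) * eps^-1.
(* Chosen so that [H ^ (2 |C| ln n) = n ^ (2 |C| ln H) <= n ^ m]; the absolute value covers a
   negative [C]. *)
pose m := (Num.truncn (2 * `|C| * ln H)).+1.
pose A := 75 * (1 + eps) ^+ 3 * H ^+ (2 * n0).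
(* The exponent 11 is 1 for the pathwidth, 3 for the cubed degree, 5 for [n ^ 5] and 2 for
   [n ln n + ln (2e) <= 3 n ^ 2]; the last 3 also gives [75 = 25 * 3]. *)
exists (A *: 'X^(m + 11)) => G fG; have admG := adm G fG.
have [/andP[e0 e1] _ _ n1 _] := admissible_facts admG.
have H1 : 1 <= H.
  by rewrite /H mulrDl divff ?gt_eqF // lerDr mul1r invr_ge0 ltW.
have lnH : 0 <= ln H by rewrite ln_ge0.
have mC : 2 * `|C| * ln H <= m%:R by rewrite ltW // truncnS_gt.
have e1' : 1 <= expR 1 :> R by rewrite -expR0 ler_expR.
have d01 : 0 < (2 * expR 1 : R)^-1 < 1.
  rewrite invr_gt0 mulr_gt0 ?expR_gt0 //= invf_lt1 ?mulr_gt0 ?expR_gt0 //.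
  by move: (expR 1) e1' => e; lra.
apply: le_trans (sf_mixing_bound admG d01) _; rewrite lee_fin invrK -/H.
rewrite hornerZ hornerXn.
set n := #|G| in n1 *; set N : R := n%:R.
have N1 : 1 <= N by rewrite ler1n; lia.
have N0 : 0 < N by lra.
have lnN : 0 <= ln N by rewrite ln_ge0.
have lnNN : ln N <= N by have := ln_le N0; lra.
have pwn : (pathwidth G)%:R <= N by rewrite ler_nat pathwidth_le.
have DN : (max_degree G)%:R <= N.
  by rewrite ler_nat; apply/bigmax_leqP => v _; exact: max_card.
have HpE : H ^+ (2 * pathwidth G) <= H ^+ (2 * n0) * N ^+ m.
  have [nn|nn] := leqP n0 n; last first.
    apply: (@le_trans _ _ (H ^+ (2 * n0))).
      rewrite ler_weXn2l // leq_mul2l /= (leq_trans (pathwidth_le G)) //; exact: ltnW.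
    by rewrite ler_peMr ?exprn_ege1 // exprn_ge0 //; lra.
  apply: (@le_trans _ _ (N ^+ m)); last first.
    by rewrite ler_peMl ?exprn_ege1 // exprn_ge0 // ltW.
  have Hpos : 0 < H by lra.
  rewrite -[H]lnK ?posrE // -[N]lnK ?posrE // -!expRM_natl ler_expR.
  have pC : (pathwidth G)%:R <= `|C| * ln N.
    by apply: le_trans (pwC G fG nn) _; rewrite ler_wpM2r // ler_norm.
  apply: (@le_trans _ _ (2 * `|C| * ln H * ln N)); last by rewrite ler_wpM2r.
  rewrite natrM [leRHS](_ : _ = 2 * (`|C| * ln N) * ln H); last by ring.
  by rewrite ler_wpM2r // ler_wpM2l.
have ln2e : ln (2 * expR 1) <= 2 :> R.
  rewrite lnM ?posrE ?expR_gt0 // expRK.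
  by have := @ln_le R 2 (ltr0n _ 2); lra.
have YN : N * ln N + ln (2 * expR 1) <= 3 * N ^+ 2.
  have : N * ln N <= N * N by rewrite ler_wpM2l // ltW.
  have : 1 <= N * N by rewrite mulr_ege1.
  rewrite expr2; move: (ln (2 * expR 1)) ln2e => l; lra.
have Y0 : 0 <= N * ln N + ln (2 * expR 1).
  rewrite addr_ge0 ?mulr_ge0 ?(ltW N0) // ln_ge0 //.
  by move: (expR 1) e1' => e; lra.
have E0 : 0 <= (1 + eps) ^+ 3 by rewrite exprn_ge0 //; lra.
have -> : A * N ^+ (m + 11) =
    25 * N * (1 + eps) ^+ 3 * N ^+ 3 * N ^+ 5 * (H ^+ (2 * n0) * N ^+ m) * (3 * N ^+ 2).
  by rewrite /A exprD; ring.
have H0 i : 0 <= H ^+ i by rewrite exprn_ge0 //; lra.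
have NN0 i : 0 <= N ^+ i by rewrite exprn_ge0 // ltW.
have pw_ge0 : 0 <= (pathwidth G)%:R :> R by rewrite ler0n.
have D_ge0 : 0 <= (max_degree G)%:R :> R by rewrite ler0n.
have c25 : 0 <= 25 :> R by [].
have P0 : 0 <= 25 * (pathwidth G)%:R * (1 + eps) ^+ 3 * (max_degree G)%:R ^+ 3.
  exact: mulr_ge0 (mulr_ge0 (mulr_ge0 c25 pw_ge0) E0) (exprn_ge0 3 D_ge0).
apply: ler_pM => //; first exact: mulr_ge0 (mulr_ge0 P0 (NN0 5)) (H0 _).
apply: ler_pM => //; first exact: mulr_ge0 P0 (NN0 5).
apply: ler_wpM2r => //; apply: ler_pM.
- exact: mulr_ge0 (mulr_ge0 c25 pw_ge0) E0.
- exact: exprn_ge0.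
- by apply: ler_wpM2r => //; apply: ler_wpM2l.
- by apply: lerXn2r; rewrite // nnegrE ltW.
Qed.
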